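(* The latticed rational-synthesis problem, for objectives given as deterministic latticed Büchi word automata (LDBW) over a finite De Morgan lattice and for the solution concept of Nash equilibrium, can be solved in exponential time.
   Context: Setting: a system (agent 0) and agents $1,\dots,n$; agent $i$ controls a finite set $X_i$ of Boolean variables (pairwise disjoint), $\Sigma_i=2^{X_i}$, $\Sigma=2^X$ with $X=\bigcup_{i=0}^n X_i$. At each step all agents simultaneously choose actions; the arena has nodes $\Sigma^*$ (histories of joint moves), starting from the empty word. A strategy for agent $i$ maps each history to an action in $\Sigma_i$; a profile $\pi=\langle\pi_0,\dots,\pi_n\rangle$ determines a unique infinite play $\mathit{outcome}(\pi)\in\Sigma^\omega$. $(\pi_{-i},\pi_i')$ denotes $\pi$ with agent $i$'s strategy replaced by $\pi_i'$. For a system strategy $\pi_0$, $\mathcal{G}_{\pi_0}$ is the game among agents $1,\dots,n$ in which agent 0 plays $\pi_0$. Let $\mathcal{L}$ be a finite De Morgan lattice (finite distributive lattice with an order-reversing involutive complement satisfying De Morgan's laws). Each agent $i\in\{0,\dots,n\}$ has an objective $\varphi_i$ given by an LDBW over alphabet $\Sigma$ and $\mathcal{L}$, which assigns to every infinite word $w\in\Sigma^\omega$ a value $\varphi_i(w)\in\mathcal{L}$ (a deterministic automaton whose transitions carry lattice values and whose Büchi acceptance condition assigns lattice values to states; the value of the word is the meet of the values along its unique run combined by meet with the join of acceptance values of states visited infinitely often). The payoff of agent $i$ under $\pi$ is $\mathit{payoff}_i(\pi)=\varphi_i(\mathit{outcome}(\pi))$. A profile $\langle\pi_1,\dots,\pi_n\rangle$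 is a Nash equilibrium in $\mathcal{G}_{\pi_0}$ if for every $1\le i\le n$ and every strategy $\pi_i'$ of agent $i$, $\mathit{payoff}_i(\pi_{-i},\pi_i')\le\mathit{payoff}_i(\pi)$ in the lattice order. Latticed rational synthesis (Nash equilibrium): given the objectives $\varphi_0,\dots,\varphi_n$ and a lattice value $v\in\mathcal{L}$, return (if one exists) a profile $\pi=\langle\pi_0,\dots,\pi_n\rangle$ such that (a) $\mathit{payoff}_0(\pi)\ge v$ and (b) $\langle\pi_1,\dots,\pi_n\rangle$ is a Nash equilibrium in $\mathcal{G}_{\pi_0}$. *)

(* Defs.v *)
From mathcomp Require Import all_boot all_order.
From mathcomp Require Import boolp.

Set Implicit Arguments.
Unset Strict Implicit.
Unset Printing Implicit Defensive.

(** Model of computation: binary trees manipulated by a point-free presentation of the WHILE language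
    (N. D. Jones, "Computability and Complexity from a Programming
    Perspective").  Values are shared pointers into a heap, so that every unit
    of cost allocates at most one cell and takes a bounded number of pointer
    operations; hence running times agree with those of Turing machines up to a
    polynomial.  There is no primitive that compares or traverses trees. *)

Inductive tree : Type := Nil | Cons of tree & tree.

Fixpoint tsize (x : tree) : nat :=
  if x is Cons y z then (tsize y + tsize z).+1 else 1.

Definition thd (x : tree) : tree := if x is Cons y _ then y else Nil.
Definition ttl (x : tree) : tree := if x is Cons _ z then z else Nil.

Inductive prog : Type :=
  | PId
  | PNil
  | PHd
  | PTl
  | PCons of prog & prog
  | PSeq of prog & prog
  | PIf of prog & prog & prog
  | PWhile of prog & prog.

(** [eval p x y t]: on input [x], the program [p] halts with output [y] after
    [t] steps.  [Nil] is the truth value false; every other tree is true. *)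
Inductive eval : prog -> tree -> tree -> nat -> Prop :=
  | EvId x : eval PId x x 1
  | EvNil x : eval PNil x Nil 1
  | EvHd x : eval PHd x (thd x) 1
  | EvTl x : eval PTl x (ttl x) 1
  | EvCons p q x y z t u :
      eval p x y t -> eval q x z u ->
      eval (PCons p q) x (Cons y z) (t + u).+1
  | EvSeq p q x y z t u :
      eval p x y t -> eval q y z u -> eval (PSeq p q) x z (t + u).+1
  | EvIfT b p q x v w y t u :
      eval b x (Cons v w) t -> eval p x y u ->
      eval (PIf b p q) x y (t + u).+1
  | EvIfF b p q x y t u :
      eval b x Nil t -> eval q x y u -> eval (PIf b p q) x y (t + u).+1
  | EvWhileT b p x v w y z t u r :
      eval b x (Cons v w) t -> eval p x y u -> eval (PWhile b p) y z r ->
      eval (PWhile b p) x z (t + u + r).+1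
  | EvWhileF b p x t :
      eval b x Nil t -> eval (PWhile b p) x x t.+1.

(** A search problem has instances in [P], encoded by [enc]; [ans I y] says
    that [y] is a correct answer for [I].  The size of the answer is charged in
    addition to the steps, because the tree unfolding of a shared heap can be
    exponentially larger than the heap itself. *)
Definition solvable_in_exptime (P : Type) (enc : P -> tree)
    (ans : P -> tree -> Prop) : Prop :=
  exists (p : prog) (c : nat), forall I : P, exists (y : tree) (t : nat),
    [/\ eval p (enc I) y t,
        t + tsize y <= 2 ^ (c * tsize (enc I) ^ c + c)
      & ans I y].

Record de_morgan (d : Order.disp_t) (L : finTBDistrLatticeType d)
    (neg : L -> L) : Prop := DeMorgan {
  de_morgan_involutive : involutive neg;
  de_morgan_antitone : forall x y, (x <= y)%O -> (neg y <= neg x)%O;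
  de_morgan_meet : forall x y, neg (x `&` y)%O = (neg x `|` neg y)%O;
  de_morgan_join : forall x y, neg (x `|` y)%O = (neg x `&` neg y)%O
}.

Record ldbw (S : Type) (L : Type) : Type := Ldbw {
  state : finType;
  init : state;
  next : state -> S -> state;
  weight : state -> S -> L;
  acc : state -> L
}.

Section Value.
Variables (S : Type) (d : Order.disp_t) (L : finTBDistrLatticeType d).
Variables (A : ldbw S L) (w : nat -> S).

Fixpoint run (k : nat) : state A :=
  if k is k'.+1 then next (run k') (w k') else init A.

(** The meet ranges over the finite set of weights occurring along the run. *)
Definition path_value : L :=
  (\meet_(l : L | `[< exists k, weight (run k) (w k) = l >]) l)%O.

Definition acc_value : L :=
  (\join_(q : state A | `[< forall m, exists2 k, m <= k & run k = q >])
     acc q)%O.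

Definition value : L := (path_value `&` acc_value)%O.

End Value.

Record problem : Type := Problem {
  disp : Order.disp_t;
  lat : finTBDistrLatticeType disp;
  neg : lat -> lat;
  negP : de_morgan neg;
  nagents : nat; (* not counting the system, which is agent [ord0] *)
  vars : finType;
  ctrl : 'I_nagents.+1 -> {set vars};
  ctrl_disjoint : forall i j, i != j -> [disjoint ctrl i & ctrl j];
  ctrl_cover : \bigcup_i ctrl i = [set: vars];
  objective : 'I_nagents.+1 -> ldbw {set vars} lat;
  threshold : lat
}.

Section Game.
Variable I : problem.

Definition agent : Type := 'I_(nagents I).+1.
Definition letter : finType := {set vars I}.

(** Histories are in chronological order. *)
Definition strategy : Type := seq letter -> letter.
Definition strategy_of (i : agent) (f : strategy) : Prop :=
  forall h, f h \subset ctrl i.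

Definition profile : Type := agent -> strategy.
Definition valid_profile (pi : profile) : Prop :=
  forall i, strategy_of i (pi i).

Definition joint_move (pi : profile) (h : seq letter) : letter :=
  \bigcup_i pi i h.

Fixpoint history (pi : profile) (k : nat) : seq letter :=
  if k is k'.+1 then rcons (history pi k') (joint_move pi (history pi k'))
  else [::].

Definition outcome (pi : profile) (k : nat) : letter :=
  joint_move pi (history pi k).

Definition deviate (pi : profile) (i : agent) (f : strategy) : profile :=
  fun j => if j == i then f else pi j.

Definition payoff (i : agent) (pi : profile) : lat I :=
  value (objective i) (outcome pi).

(** Nash equilibrium of agents [1..n] when agent 0 is bound to [pi ord0]. *)
Definition nash (pi : profile) : Prop :=
  forall i : agent, i != ord0 -> forall f, strategy_of i f ->
    (payoff i (deviate pi i f) <= payoff i pi)%O.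

Definition solution (pi : profile) : Prop :=
  [/\ valid_profile pi, (threshold I <= payoff ord0 pi)%O & nash pi].

(** Finite-state presentation of strategies, used for the answer only. *)
Record transducer : Type := Transducer {
  tstate : finType;
  tinit : tstate;
  tnext : tstate -> letter -> tstate;
  tout : tstate -> letter
}.

Definition strategy_of_transducer (T : transducer) : strategy :=
  fun h => tout (foldl (@tnext T) (tinit T) h).

End Game.

(** Elements of explicitly listed finite types are written in unary; an
    automaton over [2^X] is written with its full transition table. *)

Definition enc_seq (T : Type) (f : T -> tree) (s : seq T) : tree :=
  foldr (fun a x => Cons (f a) x) Nil s.

Definition enc_bool (b : bool) : tree := if b then Cons Nil Nil else Nil.

Definition enc_nat (n : nat) : tree := iter n (Cons Nil) Nil.

Definition enc_elt (T : finType) (a : T) : tree := enc_nat (enum_rank a).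

Definition enc_fun (T : finType) (f : T -> tree) : tree := enc_seq f (enum T).

Definition enc_set (T : finType) (B : {set T}) : tree :=
  enc_fun (fun a => enc_bool (a \in B)).

Definition enc_lattice (d : Order.disp_t) (L : finTBDistrLatticeType d)
    (neg : L -> L) : tree :=
  Cons (enc_fun (fun x : L => enc_fun (fun y : L => enc_bool (x <= y)%O)))
 (Cons (enc_fun (fun x : L => enc_fun (fun y : L => enc_elt (x `&` y)%O)))
 (Cons (enc_fun (fun x : L => enc_fun (fun y : L => enc_elt (x `|` y)%O)))
       (enc_fun (fun x : L => enc_elt (neg x))))).

Definition enc_ldbw (X : finType) (L : finType) (A : ldbw {set X} L) : tree :=
  Cons (enc_elt (init A))
    (enc_fun (fun q : state A =>
       Cons (enc_elt (acc q))
         (enc_fun (fun a : {set X} =>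
            Cons (enc_set a)
              (Cons (enc_elt (next q a)) (enc_elt (weight q a))))))).

Definition enc_problem (I : problem) : tree :=
  Cons (enc_lattice (@neg I))
 (Cons (enc_elt (threshold I))
       (enc_fun (fun i : 'I_(nagents I).+1 =>
          Cons (enc_set (ctrl i)) (enc_ldbw (objective i))))).

Definition enc_transducer (I : problem) (T : transducer I) : tree :=
  Cons (enc_elt (tinit T))
    (enc_fun (fun q : tstate T =>
       Cons (enc_set (tout q))
         (enc_fun (fun a : {set vars I} =>
            Cons (enc_set a) (enc_elt (tnext q a)))))).

Definition enc_transducers (I : problem)
    (T : 'I_(nagents I).+1 -> transducer I) : tree :=
  enc_fun (fun i => enc_transducer (T i)).

(** The answer [Nil] is correct only if no profile whatsoever, finite-state or
    not, is a solution.  An encoded profile is never [Nil], since there is at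
    least one agent. *)
Definition answer (I : problem) (y : tree) : Prop :=
  (exists2 T : 'I_(nagents I).+1 -> transducer I,
     solution (fun i => strategy_of_transducer (T i))
     & y = enc_transducers T)
  \/ (y = Nil /\ ~ exists pi : profile I, solution pi).

(* Main.v *)
(** An equilibrium with payoffs [w_i] is a play along which no agent can gain
    by deviating alone, and after a deviation the culprit is identified, since
    the agents control disjoint sets of variables.  The remaining agents then
    face a co-Buechi game: [path /\ (\/ acc) <= w_i] means that from some point
    on every visited state satisfies [meet so far /\ acc <= w_i].  Conversely
    [w_i <= \/ acc] is a generalized Buechi condition, one target for each [y]
    with [~ w_i <= y].

    On a finite arena both conditions become safety conditions once a counter
    bounded by the number of vertices is added: the number of bad states still
    tolerated after a deviation, or the number of steps left before the current
    target.  Hence a solution exists iff a suitable initial node is in the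
    greatest fixpoint of a single safety game, whose nodes carry the guessed
    payoffs [w_i], and the game itself serves as the transducer of the answer.
    The only exponential object is the product of the local state spaces;
    everything else is polynomial in its size. *)

From HB Require Import structures.
From mathcomp Require Import all_boot all_order zify.
From mathcomp Require Import boolp.
Require Import Defs.

Set Implicit Arguments.
Unset Strict Implicit.
Unset Printing Implicit Defensive.

(** * Polynomial-time programs on trees *)

(** The obstacle is completeness: an arbitrary equilibrium may use its entire history, whereas the
    nodes of the game carry bounded counters. Determinacy is bypassed. If [K] units did not suffice
    after a deviation, one infinite word consistent with the given profile could be assembled whose
    value for the culprit is not below its payoff, against the Nash condition. On the undisturbed
    play the waits for a target may be unbounded, but a recurring vertex may be continued as at any
    of its occurrences, and this shortens the wait to at most the number of vertices. Soundness does
    not need the guess [w_i] to be the payoff. It suffices that it separates the value of the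
    undisturbed play, which is at least [w_i], from those of the plays that [i] can deviate to,
    which are at most [w_i]. On the machine side, the algorithm is written as ordinary functions on
    trees, and [ptime] asserts that some program computes them. Loops are the only means of
    repetition, so every loop comes with a bound on all its intermediate states. *)

Lemma tree_comparable : comparable tree.
Proof. by move=> x y; rewrite /decidable; decide equality. Qed.
HB.instance Definition _ := hasDecEq.Build tree (compareP tree_comparable).

Fixpoint lst (t : tree) : seq tree := if t is Cons a r then a :: lst r else [::].
Fixpoint tre (s : seq tree) : tree := if s is a :: r then Cons a (tre r) else Nil.

Lemma treE s : tre s = foldr Cons Nil s.
Proof. by elim: s => //= a s ->. Qed.

Lemma lstK : cancel lst tre.
Proof. by elim=> //= a _ r ->. Qed.
Lemma treK : cancel tre lst.
Proof. by elim=> //= a r ->. Qed.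

Definition tb (t : tree) : bool := if t is Cons _ _ then true else false.
Definition tif (b x y : tree) : tree := if b is Cons _ _ then x else y.

Lemma tsize_gt0 t : 0 < tsize t.
Proof. by case: t. Qed.

(** One power stands for any polynomial: trees have positive size, so the base is at least 2 and a
    larger exponent absorbs constants and sums. *)
Definition polyb (f : tree -> nat) : Prop :=
  exists c, forall x, f x <= (tsize x).+1 ^ c.

Lemma leq_tsizeX x a b : a <= b -> (tsize x).+1 ^ a <= (tsize x).+1 ^ b.
Proof. by move=> h; apply: leq_pexp2l. Qed.

Lemma polyb_le f g : polyb f -> (forall x, g x <= f x) -> polyb g.
Proof. by move=> [c h] le; exists c => x; apply: leq_trans (le x) (h x). Qed.

Lemma leq_expl a b c : a <= b -> a ^ c <= b ^ c.
Proof. by case: c => // c le; rewrite leq_exp2r. Qed.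

Lemma polyb_cst k : polyb (fun=> k).
Proof.
exists k => x; apply: leq_trans (ltnW (ltn_expl k (ltnSn 1))) _.
by apply: leq_expl; rewrite ltnS tsize_gt0.
Qed.

Lemma polyb_size : polyb tsize.
Proof. by exists 1 => x; rewrite expn1. Qed.

Lemma polybM f g : polyb f -> polyb g -> polyb (fun x => f x * g x).
Proof. by move=> [a hf] [b hg]; exists (a + b) => x; rewrite expnD leq_mul. Qed.

Lemma polybD f g : polyb f -> polyb g -> polyb (fun x => f x + g x).
Proof.
move=> [a hf] [b hg]; exists (maxn a b).+1 => x.
have := leq_trans (hf x) (leq_tsizeX x (leq_maxl a b)).
have := leq_trans (hg x) (leq_tsizeX x (leq_maxr a b)).
rewrite expnS; have := tsize_gt0 x; nia.
Qed.

Lemma polybS f : polyb f -> polyb (fun x => (f x).+1).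
Proof.
move=> hf; apply: polyb_le (polybD hf (polyb_cst 1)) _ => x.
by rewrite addn1.
Qed.

Lemma polybX f c : polyb f -> polyb (fun x => f x ^ c).
Proof. by move=> [a hf]; exists (a * c) => x; rewrite expnM leq_expl. Qed.

(* The output is bounded separately because sharing makes its unfolding
   possibly exponential in the time. *)
Definition ptime (f : tree -> tree) : Prop :=
  exists p c, forall x, exists2 t, eval p x (f x) t &
    t + tsize (f x) <= (tsize x).+1 ^ c.

Lemma ptimeI p (T : tree -> nat) f : polyb T ->
  (forall x, exists2 t, eval p x (f x) t & t + tsize (f x) <= T x) -> ptime f.
Proof.
move=> [c hT] h; exists p, c => x; have [t et le] := h x; exists t => //.
exact: leq_trans le (hT x).
Qed.

Lemma ptime_size f : ptime f -> polyb (fun x => tsize (f x)).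
Proof. by move=> [p [c h]]; exists c => x; have [t _] := h x; lia. Qed.

Lemma polyb_comp g f : ptime f -> polyb g -> polyb (fun x => g (f x)).
Proof.
move=> hf [c hg]; apply: polyb_le (polybX c (polybS (ptime_size hf))) _ => x.
exact: hg.
Qed.

Lemma pt_id : ptime (fun x => x).
Proof.
apply: (@ptimeI PId _ _ (polybS polyb_size)) => x; exists 1; first exact: EvId.
by [].
Qed.

Lemma pt_nil : ptime (fun=> Nil).
Proof.
by apply: (@ptimeI PNil _ _ (polyb_cst 2)) => x; exists 1; first exact: EvNil.
Qed.

Lemma pt_comp f g : ptime f -> ptime g -> ptime (fun x => f (g x)).
Proof.
move=> [p [a hp]] hg; have [q [b hq]] := hg.
have hT := polybD (polyb_comp hg (g := fun x => (tsize x).+1 ^ a) (ex_intro _ a (fun=> leqnn _)))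
  (polybS (ex_intro _ b (fun=> leqnn _))).
apply: (@ptimeI (PSeq q p) _ _ hT) => x /=.
have [t et ht] := hq x; have [u eu hu] := hp (g x).
by exists (t + u).+1; [exact: EvSeq et eu | lia].
Qed.

Lemma pt_hd f : ptime f -> ptime (fun x => thd (f x)).
Proof.
apply: (@pt_comp thd); apply: (@ptimeI PHd _ _ (polybS polyb_size)) => x.
by exists 1; [exact: EvHd | case: x => //= a b; lia].
Qed.

Lemma pt_tl f : ptime f -> ptime (fun x => ttl (f x)).
Proof.
apply: (@pt_comp ttl); apply: (@ptimeI PTl _ _ (polybS polyb_size)) => x.
by exists 1; [exact: EvTl | case: x => //= a b; lia].
Qed.

Lemma pt_cons f g : ptime f -> ptime g -> ptime (fun x => Cons (f x) (g x)).
Proof.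
move=> [p [a hp]] [q [b hq]].
have hT := polybS (polybS (polybD (ex_intro _ a (fun=> leqnn _)) (ex_intro _ b (fun=> leqnn _)))).
apply: (@ptimeI (PCons p q) _ _ hT) => x /=.
have [t et ht] := hp x; have [u eu hu] := hq x.
by exists (t + u).+1; [exact: EvCons | lia].
Qed.

Lemma pt_if b f g : ptime b -> ptime f -> ptime g ->
  ptime (fun x => tif (b x) (f x) (g x)).
Proof.
move=> [r [d hr]] [p [a hp]] [q [c hq]].
have hT := polybS (polybD (polybD (ex_intro _ a (fun=> leqnn _)) (ex_intro _ c (fun=> leqnn _)))
  (ex_intro _ d (fun=> leqnn _))).
apply: (@ptimeI (PIf r p q) _ _ hT) => x /=.
have [t et ht] := hp x; have [u eu hu] := hq x; have [w ew hw] := hr x.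
case: (b x) ew hw => [|y z] ew hw /=.
  by exists (w + u).+1; [exact: EvIfF | lia].
by exists (w + t).+1; [exact: EvIfT ew et | lia].
Qed.

Lemma pt_cst c : ptime (fun=> c).
Proof. by elim: c => [|a ha b hb]; [exact: pt_nil | exact: pt_cons]. Qed.

(** A hook, redefined as closure lemmas for named functions become available, so that [pt] always
    uses the current collection. *)
Ltac pt_named := fail.
Ltac pt := repeat first
  [ assumption | simple apply pt_id | simple apply pt_cst | simple apply pt_if
  | simple apply pt_cons | simple apply pt_hd | simple apply pt_tl | pt_named ].

(* The guard of every loop is the head of the current state. *)
Lemma loop_time f : ptime f -> exists p c, forall n x B,
  (forall k, k < n -> tb (thd (iter k f x))) -> thd (iter n f x) = Nil ->
  (forall k, k <= n -> tsize (iter k f x) <= B) -> n <= B ->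
  exists2 t, eval p x (iter n f x) t & t <= B.+1 ^ c.
Proof.
move=> [p [c h]]; exists (PWhile PHd p), (c + 3) => n x B live stop size_le nB.
suff [t et le] : exists2 t, eval (PWhile PHd p) x (iter n f x) t & t <= n.+1 * (B.+1 ^ c).+2.
  exists t => //; apply: leq_trans le _; rewrite expnD.
  have B0 : 0 < B by apply: leq_trans (size_le 0 isT); apply: tsize_gt0.
  have := expn_gt0 B.+1 c; move: (B.+1 ^ c) => m m0; rewrite !expnS expn0; nia.
elim: n x live stop size_le {nB} => [|n IH] x live stop size_le.
  exists 2; last by rewrite mul1n.
  by apply: EvWhileF; rewrite -[in X in eval _ _ X](stop : thd x = Nil); apply: EvHd.
have [||| t et le] := IH (f x).
- by move=> k kn; rewrite -iterSr; apply: live.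
- by rewrite -iterSr.
- by move=> k kn; rewrite -iterSr; apply: size_le.
have [u eu hu] := h x; rewrite iterSr; exists (1 + u + t).+1.
  have := live 0 isT; rewrite /=; case E: (thd x) => [|v w] // _.
  by have := EvHd x; rewrite E => eh; apply: EvWhileT eh eu et.
have := leq_trans hu (leq_expl c (size_le 0 isT : (tsize x).+1 <= B.+1)).
by rewrite mulSn; lia.
Qed.

(** The count [n] is never computed: it only names the moment at which the guard stops the loop. *)
Lemma pt_loop f n i (B : tree -> nat) : ptime f -> ptime i -> polyb B ->
  (forall e k, k < n e -> tb (thd (iter k f (i e)))) ->
  (forall e, thd (iter (n e) f (i e)) = Nil) ->
  (forall e k, k <= n e -> tsize (iter k f (i e)) <= B e) ->
  (forall e, n e <= B e) -> ptime (fun e => iter (n e) f (i e)).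
Proof.
move=> hf [q [a hi]] hB live stop size_le nB.
have [p [c h]] := loop_time hf.
have hT := polybD (ex_intro _ a (fun=> leqnn _)) (polybD (polybX c (polybS hB)) (polybS hB)).
apply: (@ptimeI (PSeq q p) _ _ hT) => e.
have [t et ht] := hi e.
have [u eu hu] := h _ _ _ (live e) (stop e) (size_le e) (nB e).
exists (t + u).+1; first exact: EvSeq et eu.
by have := size_le e _ (leqnn _); move: hu ht => /=; lia.
Qed.

(* A foldl whose step sees the current item, the state so far and a fixed
   environment is run as a loop on [Cons items (Cons state environment)]. *)
Definition fold_step (g : tree -> tree -> tree -> tree) (x : tree) : tree :=
  Cons (ttl (thd x)) (Cons (g (thd (thd x)) (thd (ttl x)) (ttl (ttl x))) (ttl (ttl x))).

Definition ptime3 (g : tree -> tree -> tree -> tree) : Prop :=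
  ptime (fun x => g (thd x) (thd (ttl x)) (ttl (ttl x))).

Lemma iter_fold_step g l z e k : k <= size (lst l) ->
  iter k (fold_step g) (Cons l (Cons z e)) =
  Cons (tre (drop k (lst l)))
       (Cons (foldl (fun acc a => g a acc e) z (take k (lst l))) e).
Proof.
elim: k => [|k IH] kl; first by rewrite drop0 take0 lstK.
rewrite iterS IH; last exact: ltnW.
rewrite (take_nth Nil kl) (drop_nth Nil kl) foldl_rcons.
by [].
Qed.

Lemma pt_app3 g a b c : ptime3 g -> ptime a -> ptime b -> ptime c ->
  ptime (fun x => g (a x) (b x) (c x)).
Proof.
move=> hg ha hb hc.
exact: (pt_comp (g := fun x => Cons (a x) (Cons (b x) (c x))) hg (pt_cons ha (pt_cons hb hc))).
Qed.

Lemma pt_fold_step g : ptime3 g -> ptime (fold_step g).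
Proof.
by move=> hg; rewrite /fold_step; pt; apply: (pt_app3 hg); pt. Qed.

Lemma size_lst t : size (lst t) <= tsize t.
Proof. by elim: t => //= a _ r; lia. Qed.

Lemma tsize_drop k t : tsize (tre (drop k (lst t))) <= tsize t.
Proof. by elim: t k => [|a _ r IH] [|k] //=; rewrite ?lstK //; have := IH k; lia. Qed.

(** Here [B] is an arbitrary number, not a polynomial in the input: the fold that lists all vertices
    has exponentially large states, and its time is polynomial in their size. *)
Lemma fold_time g : ptime3 g -> exists p c, forall l z e B,
  (forall k, tsize (foldl (fun acc a => g a acc e) z (take k (lst l))) <= B) ->
  tsize l <= B -> tsize e <= B ->
  exists2 t, eval p (Cons l (Cons z e))
    (Cons Nil (Cons (foldl (fun acc a => g a acc e) z (lst l)) e)) t &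
    t <= B.+1 ^ c.
Proof.
move=> /pt_fold_step/loop_time[p [c h]]; exists p, (4 * c) => l z e B hB hl he.
(* Two pairs with three components of size at most [B]. The base [3 * B + 3] is at most [B.+1 ^ 4],
   whence the exponent [4 * c]. *)
have [|||| t] := h (size (lst l)) (Cons l (Cons z e)) (3 * B).+2.
- by move=> k kl; rewrite iter_fold_step ?(ltnW kl) //= (drop_nth Nil kl).
- by rewrite iter_fold_step // drop_size.
- move=> k kl; rewrite iter_fold_step //=.
  by have := hB k; have := tsize_drop k l; lia.
- by have := size_lst l; lia.
rewrite iter_fold_step // drop_size take_size => et le; exists t => //.
apply: leq_trans le _; rewrite expnM; apply: leq_expl.
by have := leq_trans (tsize_gt0 l) hl; rewrite !expnS expn0; nia.
Qed.

Lemma pt_foldl g z l (B : tree -> nat) :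
  ptime3 g -> ptime z -> ptime l -> polyb B ->
  (forall e k, tsize (foldl (fun acc a => g a acc e) (z e) (take k (lst (l e)))) <= B e) ->
  ptime (fun e => foldl (fun acc a => g a acc e) (z e) (lst (l e))).
Proof.
move=> hg hz hl hB size_le.
pose i e := Cons (l e) (Cons (z e) e); pose n e := size (lst (l e)).
have hi : ptime i by apply: pt_cons => //; apply: pt_cons => //; apply: pt_id.
pose C e := B e + tsize (i e).
have /pt_tl/pt_hd : ptime (fun e => iter (n e) (fold_step g) (i e)).
  apply: (@pt_loop _ n i C) => //; first exact: pt_fold_step.
  - by apply: polybD => //; apply: ptime_size.
  - by move=> e k kn; rewrite iter_fold_step ?(ltnW kn) //= (drop_nth Nil kn).
  - by move=> e; rewrite iter_fold_step // drop_size.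
  - move=> e k kn; rewrite iter_fold_step //= /C /i /=.
    by have := size_le e k; have := tsize_drop k (l e); lia.
  - by move=> e; rewrite /n /C /=; have := size_lst (l e); lia.
congr ptime; apply/funext => e.
by rewrite iter_fold_step // take_size.
Qed.

(** A loop consumes a list from the front, so a right fold is run as a left fold over the reversed
    list. *)
Definition trev (l : tree) : tree := foldl (fun acc a => Cons a acc) Nil (lst l).

Lemma trevE l : trev l = tre (rev (lst l)).
Proof.
by rewrite /trev; elim/last_ind: (lst l) => // s a IH; rewrite foldl_rcons rev_rcons IH.
Qed.

Lemma tsize_tre s : tsize (tre s) = (sumn [seq (tsize a).+1 | a <- s]).+1.
Proof. by elim: s => //= a s ->; lia. Qed.

Lemma tsize_tre_le b s : all (fun a => tsize a <= b) s ->
  tsize (tre s) <= (size s * b.+1).+1.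
Proof. by elim: s => //= a s IH /andP[ha /IH]; rewrite mulSn; lia. Qed.

Lemma lst_small l : all (fun a => tsize a <= tsize l) (lst l).
Proof.
elim: l => //= a _ r IH; apply/andP; split; first lia.
by apply: sub_all IH => b /=; lia.
Qed.

Lemma tsize_rev_take k l : tsize (tre (rev (take k (lst l)))) <= tsize l.
Proof.
rewrite tsize_tre map_rev sumn_rev -[X in _ <= tsize X]lstK tsize_tre.
by rewrite -[in leqRHS](cat_take_drop k (lst l)) map_cat sumn_cat; lia.
Qed.

Lemma pt_rev l : ptime l -> ptime (fun e => trev (l e)).
Proof.
move=> hl; apply: (@pt_foldl (fun a acc _ => Cons a acc) (fun=> Nil) l (fun e => tsize (l e))) => //.
- apply: pt_cons; first by apply: pt_hd; apply: pt_id.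
  by apply: pt_hd; apply: pt_tl; apply: pt_id.
- exact: pt_nil.
- exact: ptime_size.
move=> e k; have := trevE (tre (take k (lst (l e)))); rewrite /trev treK => ->.
exact: tsize_rev_take.
Qed.

Lemma pt_foldr g z l (B : tree -> nat) :
  ptime3 g -> ptime z -> ptime l -> polyb B ->
  (forall e k, tsize (foldr (fun a acc => g a acc e) (z e) (drop k (lst (l e)))) <= B e) ->
  ptime (fun e => foldr (fun a acc => g a acc e) (z e) (lst (l e))).
Proof.
move=> hg hz hl hB size_le.
have : ptime (fun e => foldl (fun acc a => g a acc e) (z e) (lst (trev (l e)))).
  apply: (pt_foldl hg hz (pt_rev hl) hB) => e k.
  by rewrite trevE treK take_rev foldl_rev.
by congr ptime; apply/funext => e; rewrite trevE treK foldl_rev.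
Qed.

(** * List operations and equality of trees in polynomial time *)

Definition tmap (f : tree -> tree) (l : tree) : tree := tre (map f (lst l)).
Definition tfilter (p : tree -> tree) (l : tree) : tree :=
  tre (filter (fun a => tb (p a)) (lst l)).
Definition tcat (l r : tree) : tree := tre (lst l ++ lst r).
Definition tflat (l : tree) : tree := tre (flatten (map lst (lst l))).
Definition lk (l n : tree) : tree := nth Nil (lst l) (size (lst n)).

Definition ptime2 (f : tree -> tree -> tree) : Prop :=
  ptime (fun x => f (thd x) (ttl x)).

Lemma pt_app2 f a b : ptime2 f -> ptime a -> ptime b -> ptime (fun x => f (a x) (b x)).
Proof. by move=> hf ha hb; apply: (pt_comp (g := fun x => Cons (a x) (b x)) hf (pt_cons ha hb)). Qed.

Lemma pt_var3 : [/\ ptime thd, ptime (fun x => thd (ttl x)) & ptime (fun x => ttl (ttl x))].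
Proof.
split; first by apply: pt_hd; apply: pt_id.
  by apply: pt_hd; apply: pt_tl; apply: pt_id.
by do 2!apply: pt_tl; apply: pt_id.
Qed.

Lemma pt_map f l : ptime2 f -> ptime l -> ptime (fun e => tmap (fun a => f a e) (l e)).
Proof.
move=> hf hl; have [v1 v2 v3] := pt_var3; have [c hc] := ptime_size hf.
(* Bounds every image [f a e], as an item [a] is no larger than the list [l e]. *)
pose b e := (tsize (l e) + tsize e).+2 ^ c.
have -> : (fun e => tmap (fun a => f a e) (l e)) =
    (fun e => foldr (fun a acc => Cons (f a e) acc) Nil (lst (l e))).
  by apply/funext => e; rewrite /tmap treE foldr_map.
apply: (@pt_foldr (fun a acc e => Cons (f a e) acc) (fun=> Nil) l
    (fun e => (tsize (l e) * (b e).+1).+1)) => //.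
- by apply: pt_cons => //; apply: pt_app2.
- exact: pt_nil.
- apply: polybS; apply: polybM; first exact: ptime_size.
  apply: polybS; apply: polybX; do 2!apply: polybS.
  by apply: polybD; [exact: ptime_size | exact: polyb_size].
move=> e k; rewrite -(foldr_map (fun a => f a e) Cons) -treE.
have := @tsize_tre_le (b e) [seq f a e | a <- drop k (lst (l e))].
rewrite size_map size_drop all_map => /(_ _)/leq_trans; apply.
  have : all (fun a => tsize a <= tsize (l e)) (drop k (lst (l e))).
    by have := lst_small (l e); rewrite -{1}(cat_take_drop k (lst (l e))) all_cat => /andP[].
  apply: sub_all => a ha /=; apply: leq_trans (hc (Cons a e)) _.
  by apply: leq_expl; rewrite /=; lia.
by have := size_lst (l e); rewrite ltnS leq_mul2r; lia.
Qed.

Lemma tsize_filter P s : tsize (tre (filter P s)) <= tsize (tre s).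
Proof. by elim: s => //= a s IH; case: (P a) => /=; lia. Qed.

Lemma pt_filter p l : ptime2 p -> ptime l -> ptime (fun e => tfilter (fun a => p a e) (l e)).
Proof.
move=> hp hl; have [v1 v2 v3] := pt_var3.
have tfilterE e s : foldr (fun a acc => tif (p a e) (Cons a acc) acc) Nil s =
    tre (filter (fun a => tb (p a e)) s).
  by elim: s => //= a s ->; case: (p a e).
have -> : (fun e => tfilter (fun a => p a e) (l e)) =
    (fun e => foldr (fun a acc => tif (p a e) (Cons a acc) acc) Nil (lst (l e))).
  by apply/funext => e; rewrite tfilterE.
apply: (@pt_foldr (fun a acc e => tif (p a e) (Cons a acc) acc) (fun=> Nil) l
    (fun e => tsize (l e))) => //.
- by apply: pt_if; [apply: pt_app2 | apply: pt_cons | ].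
- exact: pt_nil.
- exact: ptime_size.
by move=> e k; rewrite tfilterE; apply: leq_trans (tsize_filter _ _) (tsize_drop _ _).
Qed.

Lemma tcatE l r : tcat l r = foldr Cons r (lst l).
Proof. by rewrite /tcat !treE foldr_cat -treE lstK. Qed.

Lemma tsize_cat s r : tsize (foldr Cons r s) <= tsize (tre s) + tsize r.
Proof. by elim: s => //= a s; lia. Qed.

Lemma pt_cat l r : ptime l -> ptime r -> ptime (fun e => tcat (l e) (r e)).
Proof.
move=> hl hr; have [v1 v2 v3] := pt_var3.
have -> : (fun e => tcat (l e) (r e)) = (fun e => foldr Cons (r e) (lst (l e))).
  by apply/funext => e; rewrite tcatE.
apply: (@pt_foldr (fun a acc _ => Cons a acc) r l (fun e => tsize (l e) + tsize (r e))) => //.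
- exact: pt_cons.
- by apply: polybD; apply: ptime_size.
by move=> e k; apply: leq_trans (tsize_cat _ _) _; rewrite leq_add2r tsize_drop.
Qed.

Lemma pt_flat l : ptime l -> ptime (fun e => tflat (l e)).
Proof.
move=> hl; have [v1 v2 v3] := pt_var3.
have tflatE s : foldr (fun a acc => tcat a acc) Nil s = tre (flatten (map lst s)).
  by elim: s => //= a s ->; rewrite /tcat treK.
have -> : (fun e => tflat (l e)) = (fun e => foldr (fun a acc => tcat a acc) Nil (lst (l e))).
  by apply/funext => e; rewrite tflatE.
apply: (@pt_foldr (fun a acc _ => tcat a acc) (fun=> Nil) l (fun e => tsize (l e))) => //.
- exact: pt_cat.
- exact: pt_nil.
- exact: ptime_size.
move=> e k; apply: leq_trans (tsize_drop k _).
elim: (drop _ _) => //= a s IH; rewrite tcatE.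
by have := tsize_cat (lst a) (foldr (fun a acc => tcat a acc) Nil s); rewrite lstK; lia.
Qed.

Lemma pt_lk l n : ptime l -> ptime n -> ptime (fun e => lk (l e) (n e)).
Proof.
move=> hl hn; have [v1 v2 v3] := pt_var3.
have dropE s t : foldl (fun acc _ => ttl acc) t s = tre (drop (size s) (lst t)).
  elim: s t => [|a s IH] t /=; first by rewrite drop0 lstK.
  by rewrite IH; case: t.
have -> : (fun e => lk (l e) (n e)) =
    (fun e => thd (foldl (fun acc _ => ttl acc) (l e) (lst (n e)))).
  apply/funext => e; rewrite dropE /lk; elim: (lst (l e)) (size _) => [|a s IH] [|m] //=.
apply/pt_hd/(@pt_foldl (fun _ acc _ => ttl acc) l n (fun e => tsize (l e))) => //.
- exact: pt_tl.
- exact: ptime_size.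
by move=> e k; rewrite dropE tsize_drop.
Qed.

Definition tiota (l : tree) : tree := tre (map enc_nat (iota 0 (size (lst l)))).

Lemma tsize_nat n : tsize (enc_nat n) = n.*2.+1.
Proof. by elim: n => //= n ->; lia. Qed.

Lemma lst_nat n : lst (enc_nat n) = nseq n Nil.
Proof. by elim: n => //= n ->. Qed.

Lemma pt_iota l : ptime l -> ptime (fun e => tiota (l e)).
Proof.
move=> hl; have [v1 v2 v3] := pt_var3.
have iotaE s : foldr (fun _ acc => Cons Nil (tmap (Cons Nil) acc)) Nil s =
    tre (map enc_nat (iota 0 (size s))).
  elim: s => //= _ s ->; congr Cons.
  by rewrite /tmap treK -[1]/(1 + 0) iotaDl -!map_comp.
have -> : (fun e => tiota (l e)) =
    (fun e => foldr (fun _ acc => Cons Nil (tmap (Cons Nil) acc)) Nil (lst (l e))).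
  by apply/funext => e; rewrite iotaE.
apply: (@pt_foldr (fun _ acc _ => Cons Nil (tmap (Cons Nil) acc)) (fun=> Nil) l
    (fun e => (tsize (l e) * ((tsize (l e)).*2.+1).+1).+1)) => //.
- apply: pt_cons; first exact: pt_nil.
  apply: (@pt_map (fun a _ => Cons Nil a)) => //.
  by apply: pt_cons; first exact: pt_nil.
- exact: pt_nil.
- have h := ptime_size hl; apply: polybS; apply: polybM => //; do 2!apply: polybS.
  by apply: polyb_le (polybD h h) _ => e; rewrite addnn.
move=> e k; rewrite iotaE size_drop.
have := @tsize_tre_le (tsize (l e)).*2.+1 [seq enc_nat i | i <- iota 0 (size (lst (l e)) - k)].
have h := size_lst (l e).
rewrite size_map size_iota => /(_ _)/leq_trans; apply; last by rewrite ltnS leq_mul2r; lia.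
by apply/allP => _ /mapP[i + ->]; rewrite mem_iota tsize_nat; lia.
Qed.

(* Lists of pending left and right subtrees, compared in lockstep; the final
   second component is [Nil] exactly when no mismatch was met. *)
Definition eq_step (st : tree) : tree :=
  let xs := thd st in let ys := ttl st in
  let bad := Cons Nil (Cons Nil Nil) in
  tif (thd xs)
    (tif (thd ys)
      (Cons (Cons (thd (thd xs)) (Cons (ttl (thd xs)) (ttl xs)))
            (Cons (thd (thd ys)) (Cons (ttl (thd ys)) (ttl ys))))
      bad)
    (tif (thd ys) bad (Cons (ttl xs) (ttl ys))).

(** Unless it meets a mismatch and stops, a step consumes one node of the pending left subtrees, so
    their total size bounds the number of steps. The 5 is the size of the mismatch state. *)
Lemma eq_step_run s1 s2 : size s1 = size s2 ->
  exists n r, [/\ n <= sumn (map tsize s1),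
    forall k, k < n -> tb (thd (iter k eq_step (Cons (tre s1) (tre s2)))),
    iter n eq_step (Cons (tre s1) (tre s2)) = Cons Nil r,
    tb r = (s1 != s2)
  & forall k, k <= n -> tsize (iter k eq_step (Cons (tre s1) (tre s2))) <=
      tsize (tre s1) + tsize (tre s2) + 5].
Proof.
have [m] := ubnP (sumn (map tsize s1)); elim: m s1 s2 => // m IH [|x s1] [|y s2] //=.
  move=> _ _; exists 0, Nil; split=> // k; rewrite leqn0 => /eqP-> /=; lia.
rewrite ltnS => hm [eq_size].
have step t1 t2 n r b st : st = Cons (Cons x (tre s1)) (Cons y (tre s2)) ->
    eq_step st = Cons t1 t2 -> n.+1 <= tsize x + sumn (map tsize s1) ->
    (forall k, k < n -> tb (thd (iter k eq_step (Cons t1 t2)))) ->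
    iter n eq_step (Cons t1 t2) = Cons Nil r -> tb r = b ->
    (forall k, k <= n -> tsize (iter k eq_step (Cons t1 t2)) <=
        (tsize x + tsize (tre s1)).+1 + (tsize y + tsize (tre s2)).+1 + 5) ->
    exists n r, [/\ n <= tsize x + sumn (map tsize s1),
    forall k, k < n -> tb (thd (iter k eq_step st)),
    iter n eq_step st = Cons Nil r, tb r = b
  & forall k, k <= n -> tsize (iter k eq_step st) <=
      (tsize x + tsize (tre s1)).+1 + (tsize y + tsize (tre s2)).+1 + 5].
  move=> def_st est n_le live stop eb sz; exists n.+1, r; split=> //.
  - by move=> [|k] kn; [rewrite def_st | rewrite iterSr est; apply: live].
  - by rewrite iterSr est.
  - by move=> [|k] kn; [rewrite def_st /=; lia | rewrite iterSr est; apply: sz].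
have eqc : (x :: s1 != y :: s2) = (x != y) || (s1 != s2) by rewrite eqseq_cons negb_and.
case: x y hm step eqc => [|x1 x2] [|y1 y2] /= hm step eqc.
- have [||n [r [le live stop eb sz]]] := IH s1 s2; [lia | by [] |].
  apply: (step (tre s1) (tre s2) n r) => //; [by rewrite eqc eqxx eb |].
  by move=> k /sz; lia.
- apply: (step Nil (Cons Nil Nil) 0 (Cons Nil Nil)); [by [] | by [] | lia | by [] | by [] | by rewrite eqc; case: eqP |].
  by move=> k; rewrite leqn0 => /eqP-> /=; lia.
- apply: (step Nil (Cons Nil Nil) 0 (Cons Nil Nil)); [by [] | by [] | lia | by [] | by [] | by rewrite eqc; case: eqP |].
  by move=> k; rewrite leqn0 => /eqP-> /=; lia.
- have [||n [r [le live stop eb sz]]] := IH (x1 :: x2 :: s1) (y1 :: y2 :: s2).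
  + by rewrite /=; lia.
  + by rewrite /= eq_size.
  apply: (step (tre (x1 :: x2 :: s1)) (tre (y1 :: y2 :: s2)) n r) => //.
  + by rewrite /= in le *; lia.
  + rewrite eb eqc !eqseq_cons -negb_and; congr negb.
    by rewrite andbA; congr andb; apply/andP/eqP => [[/eqP-> /eqP->]|[-> ->]].
  + by move=> k /sz /=; lia.
Qed.

Lemma teq_subproof x y : exists n,
  [/\ n <= (tsize x).+2,
    forall k, k < n -> tb (thd (iter k eq_step (Cons (Cons x Nil) (Cons y Nil)))),
    thd (iter n eq_step (Cons (Cons x Nil) (Cons y Nil))) = Nil,
    tb (ttl (iter n eq_step (Cons (Cons x Nil) (Cons y Nil)))) = (x != y)
  & forall k, k <= n -> tsize (iter k eq_step (Cons (Cons x Nil) (Cons y Nil))) <=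
      tsize x + tsize y + 9].
Proof.
have [n [r [le live stop eb sz]]] := @eq_step_run [:: x] [:: y] erefl.
exists n; rewrite stop eb eqseq_cons andbT; split=> //; rewrite /= in le sz *; first lia.
by move=> k /sz; lia.
Qed.

(** Chosen classically, since only the specification of the loop mentions this number. *)
Definition eq_steps (x y : tree) : nat := sval (cid (teq_subproof x y)).

Definition teq (x y : tree) : tree :=
  tif (ttl (iter (eq_steps x y) eq_step (Cons (Cons x Nil) (Cons y Nil))))
      Nil (Cons Nil Nil).

Lemma tb_eq x y : tb (teq x y) = (x == y).
Proof.
rewrite /teq /eq_steps; case: cid => n /= [_ _ _ eb _].
by case: ttl eb => /= [|_ _] /esym; [move/negbFE | move/negbTE].
Qed.

Lemma pt_eq f g : ptime f -> ptime g -> ptime (fun e => teq (f e) (g e)).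
Proof.
move=> hf hg.
pose i e := Cons (Cons (f e) Nil) (Cons (g e) Nil); pose n e := eq_steps (f e) (g e).
have /pt_tl h : ptime (fun e => iter (n e) eq_step (i e)).
  apply: (@pt_loop _ n i (fun e => tsize (f e) + tsize (g e) + 9)).
  - by rewrite /eq_step; pt.
  - by rewrite /i; pt.
  - exact: polybD (polybD (ptime_size hf) (ptime_size hg)) (polyb_cst 9).
  - by move=> e; rewrite /n /eq_steps; case: cid => m /= [le live stop _ sz] //; lia.
  - by move=> e; rewrite /n /eq_steps; case: cid => m /= [le live stop _ sz] //; lia.
  - by move=> e; rewrite /n /eq_steps; case: cid => m /= [le live stop _ sz] //; lia.
  - by move=> e; rewrite /n /eq_steps; case: cid => m /= [le live stop _ sz] //; lia.
exact: (pt_if h pt_nil (pt_cst (Cons Nil Nil))).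
Qed.

(** The greatest fixpoint of a monotone filter on [l]. As many rounds as [l] has items suffice, so
    [l] doubles as the loop counter. *)
Definition tgfp (p : tree -> tree -> tree) (l : tree) : tree :=
  foldl (fun acc _ => tfilter (p acc) l) l (lst l).

Lemma pt_gfp p l : ptime3 p -> ptime l -> ptime (fun e => tgfp (fun acc a => p acc a e) (l e)).
Proof.
move=> hp hl; have [v1 v2 v3] := pt_var3.
apply: (@pt_foldl (fun _ acc e => tfilter (fun a => p acc a e) (l e)) l l (fun e => tsize (l e))) => //.
- apply: (@pt_filter (fun a x => p (thd (ttl x)) a (ttl (ttl x)))).
  + by apply: (pt_app3 hp); pt.
  + exact: pt_comp hl v3.
- exact: ptime_size.
move=> e k; case/lastP: (take k _) => // s a; rewrite foldl_rcons.
by apply: leq_trans (tsize_filter _ _) _; rewrite lstK.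
Qed.

Section Gfp.
Variables (p : tree -> tree -> tree) (l : tree).
Hypothesis mono : forall X Y a, {subset lst X <= lst Y} -> tb (p X a) -> tb (p Y a).

Let F X := tfilter (p X) l.

Lemma tgfpE : tgfp p l = iter (size (lst l)) F l.
Proof.
suff h (s : seq tree) z : foldl (fun X _ => F X) z s = iter (size s) F z by exact: h.
by elim: s z => //= b s IH z; rewrite IH -iterS iterSr.
Qed.

Lemma mem_gfp_step X a : (a \in lst (F X)) = (a \in lst l) && tb (p X a).
Proof. by rewrite /F treK mem_filter andbC. Qed.

Lemma gfp_decr k : {subset lst (iter k.+1 F l) <= lst (iter k F l)}.
Proof.
elim: k => [|k IH] b; first by rewrite mem_gfp_step => /andP[].
by rewrite !iterS mem_gfp_step => /andP[bl /(mono IH) pb]; rewrite mem_gfp_step bl.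
Qed.

(** Each round filters all of [l]; by monotonicity it equally filters the previous iterate, so that
    equal sizes force equal lists. *)
Lemma gfp_filter k :
  lst (iter k.+1 F l) = filter (fun a => tb (p (iter k F l) a)) (lst (iter k F l)).
Proof.
rewrite iterS [in LHS]/F treK; case: k => [//|k].
rewrite [in X in _ = filter _ X]iterS [in X in _ = filter _ X]/F treK -filter_predI.
apply: eq_in_filter => a al /=; apply/idP/andP => [h|[]//]; split=> //.
exact: mono (@gfp_decr k) h.
Qed.

(** Until it stabilizes, the list loses an item per round. In the end it is stable or empty, and an
    empty iterate is stable because the iterates decrease. *)
Lemma gfp_fix : F (tgfp p l) = tgfp p l.
Proof.
rewrite tgfpE.
have h k : F (iter k F l) = iter k F l \/ size (lst (iter k F l)) + k <= size (lst l).
  elim: k => [|k [IH|IH]]; first by right; rewrite addn0.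
    by left; rewrite iterS IH.
  have e := gfp_filter k; have := count_size (fun a => tb (p (iter k F l) a)) (lst (iter k F l)).
  rewrite leq_eqVlt => /orP[/eqP eqc|].
    have /all_filterP fs : all (fun a => tb (p (iter k F l) a)) (lst (iter k F l)).
      by rewrite all_count eqc.
    by left; move: e; rewrite fs => /(can_inj lstK) fix_; rewrite fix_ -iterS fix_.
  by right; rewrite e size_filter; lia.
have [//|] := h (size (lst l)).
have := @gfp_decr (size (lst l)); rewrite iterS.
by case: (iter _ F l) => [|a r] /=; [case: (F Nil) => // a r /(_ a); rewrite inE eqxx => /(_ isT) | lia].
Qed.

Lemma gfp_unfold a : a \in lst (tgfp p l) -> a \in lst l /\ tb (p (tgfp p l) a).
Proof. by rewrite -{1}gfp_fix mem_gfp_step => /andP[]. Qed.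

Lemma gfp_coind X : (forall a, a \in lst X -> a \in lst l /\ tb (p X a)) ->
  {subset lst X <= lst (tgfp p l)}.
Proof.
rewrite tgfpE => h; elim: (size _) => [|k IH] a aX; first by case: (h a aX).
by have [al pa] := h a aX; rewrite iterS mem_gfp_step al (mono IH).
Qed.
End Gfp.

(** * Values of words under latticed automata *)

Lemma finite_bound (T : finType) (P : T -> nat -> Prop) :
  (forall x, exists m, forall k, m <= k -> P x k) ->
  exists m, forall k, m <= k -> forall x, P x k.
Proof.
move=> h; pose m x := sval (cid (h x)).
exists (\max_x m x) => k le x; apply: (svalP (cid (h x))).
by apply: leq_trans le; apply: leq_bigmax.
Qed.

Section ValueTheory.
Import Order.TTheory.
Variables (S : Type) (d : Order.disp_t) (L : finTBDistrLatticeType d).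
Variables (A : ldbw S L) (w : nat -> S).

Fixpoint path_meet (k : nat) : L :=
  if k is k'.+1 then (path_meet k' `&` weight (run A w k') (w k'))%O else \top%O.

Lemma path_value_le k : (path_value A w <= weight (run A w k) (w k))%O.
Proof. by apply: meets_inf; apply/asboolP; exists k. Qed.

Lemma le_path_value y :
  (forall k, (y <= weight (run A w k) (w k))%O) -> (y <= path_value A w)%O.
Proof. by move=> h; apply: meets_ge => l /asboolP[k <-]. Qed.

Lemma path_meet_ge k : (path_value A w <= path_meet k)%O.
Proof. by elim: k => /= [|k IH]; rewrite ?lex1 // lexI IH path_value_le. Qed.

Lemma path_meet_le j k : j < k -> (path_meet k <= weight (run A w j) (w j))%O.
Proof.
elim: k => // k IH; rewrite ltnS leq_eqVlt => /orP[/eqP->|/IH h] /=; first exact: leIr.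
by apply: le_trans h; apply: leIl.
Qed.

Lemma path_meet_stable : exists m, forall k, m <= k -> path_meet k = path_value A w.
Proof.
have [|m hm] := @finite_bound L (fun l k =>
    (exists j, weight (run A w j) (w j) = l) -> (path_meet k <= l)%O).
  move=> l; have [[j jl]|nj] := pselect (exists j, weight (run A w j) (w j) = l).
    by exists j.+1 => k /path_meet_le; rewrite jl.
  by exists 0 => k _ /nj.
exists m => k mk; apply/le_anti; rewrite path_meet_ge andbT.
by apply: meets_ge => l /asboolP; apply: hm mk l.
Qed.

Let inf q := forall m, exists2 k, m <= k & run A w k = q.

Lemma run_inf : exists m, forall k, m <= k -> inf (run A w k).
Proof.
have [|m hm] := @finite_bound (state A) (fun q k => run A w k = q -> inf q).
  move=> q; have [iq|/existsNP[m niq]] := pselect (inf q); first by exists 0.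
  by exists m => k mk qk; case: niq; exists k.
by exists m => k mk; apply: hm mk _ erefl.
Qed.

Lemma acc_value_ge q : inf q -> (acc q <= acc_value A w)%O.
Proof. by move=> iq; apply: joins_sup; apply/asboolP. Qed.

(** By finiteness, from some point on the running meet is constant and only states visited
    infinitely often occur. The inequalities for these states then combine into one for their join
    by distributivity. *)
Lemma value_leP v : (value A w <= v)%O <->
  exists m, forall k, m <= k -> (path_meet k `&` acc (run A w k) <= v)%O.
Proof.
have [m1 h1] := path_meet_stable; have [m2 h2] := run_inf; split=> [le|[m hm]].
  exists (maxn m1 m2) => k; rewrite geq_max => /andP[k1 k2].
  by rewrite h1 //; apply: le_trans le; apply: leI2 => //; apply/acc_value_ge/h2.
rewrite /value /acc_value; apply: (big_ind (fun y => path_value A w `&` y <= v)%O).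
- by rewrite meetx0 le0x.
- by move=> x y hx hy; rewrite meetUr leUx hx hy.
move=> q /asboolP iq; have [k mk <-] := (iq : inf q) (maxn m m1).
by move: mk; rewrite geq_max => /andP[k1 k2]; rewrite -(h1 k) // hm.
Qed.

(** For the converse take [y] to be the join [acc_value A w] itself: late states are visited
    infinitely often, so none of them can fail to be below it. *)
Lemma le_valueP v : (v <= value A w)%O <->
  (forall k, (v <= weight (run A w k) (w k))%O) /\
  (forall y m, ~~ (v <= y)%O -> exists2 k, m <= k & ~~ (acc (run A w k) <= y)%O).
Proof.
rewrite lexI; split=> [/andP[hp ha]|[hw ha]].
  split=> [k|y m]; first exact: le_trans hp (path_value_le k).
  apply: contraNP => none; apply: le_trans ha _; apply: joins_le => q /asboolP iq.
  have [k mk <-] := (iq : inf q) m.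
  by apply: contraT => bad; case: none; exists k.
rewrite le_path_value //=; apply: contraT => nle; have [m hm] := run_inf.
by have [k mk] := ha _ m nle; rewrite acc_value_ge //; apply: hm.
Qed.

End ValueTheory.

(** * The safety game *)

Section Arena.
Import Order.TTheory.
Variable I : problem.
Notation agent := 'I_(nagents I).+1.
Notation letter := (letter I).

(* Automaton state, meet of the weights read so far, and guessed payoff; the last
   component never changes along a play. *)
Definition local (i : agent) : finType := (state (objective i) * (lat I * lat I))%type.
Definition vertex : finType := {dffun forall i : agent, local i}.

Definition laut (i : agent) (s : local i) := s.1.
Definition lmeet (i : agent) (s : local i) := s.2.1.
Definition lval (i : agent) (s : local i) := s.2.2.

Definition move1 (b : letter) (i : agent) (s : local i) : local i :=
  (next (laut s) b, ((lmeet s `&` weight (laut s) b)%O, lval s)).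
Definition move (u : vertex) (b : letter) : vertex :=
  [ffun i => move1 b (u i)].

(* [b] may result from [a] by a deviation of agent [i] alone; the system does not
   deviate, so [sim ord0] is equality. *)
Definition sim (i : agent) (a b : letter) : bool :=
  [forall p, (i != ord0) && (p \in ctrl i) || ((p \in a) == (p \in b))].

(** The enumeration starts with [ord0], so equal letters yield [ord0]. A change that no single agent
    explains also yields [ord0], by default; in mode [ord0] it is then not [legal], because
    [sim ord0] is equality. *)
Definition culprit (a b : letter) : agent :=
  head ord0 (filter (fun i => sim i a b) (enum 'I_(nagents I).+1)).

Definition bad (i : agent) (u : vertex) : bool :=
  ~~ (lmeet (u i) `&` acc (laut (u i)) <= lval (u i))%O.

Definition targets : seq (agent * lat I) :=
  [seq (i, y) | i <- enum 'I_(nagents I).+1, y <- enum (lat I)].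

(** A pair whose [y] is above the guessed payoff demands nothing and counts as met at once; this
    allows all pairs to be served in one fixed cyclic order. *)
Definition hit (u : vertex) (j : nat) : bool :=
  let t := nth (ord0, \top%O) targets j in
  (lval (u t.1) <= t.2)%O || ~~ (acc (laut (u t.1)) <= t.2)%O.

Implicit Types (a b : letter) (i : agent) (u : vertex).
(** An upper bound is enough, and [K] will be the length of a computed list that contains every
    vertex. *)
Variable K : nat.
Hypothesis vertex_leK : #|vertex| <= K.

Let J := size targets.

(* Mode, vertex, target, counter.  Mode [ord0] means that nobody has deviated, mode
   [i] that agent [i] has; the target is only used in mode [ord0]. *)
Definition node : Type := (agent * (vertex * (nat * nat)))%type.
Definition nmode (s : node) := s.1.
Definition nvert (s : node) := s.2.1.
Definition ntgt (s : node) := s.2.2.1.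
Definition ncnt (s : node) := s.2.2.2.

Definition mode_after (m : agent) (a b : letter) : agent :=
  if m == ord0 then culprit a b else m.

(** Targets and counters run downwards, because the predecessor of a unary number is just its tail.
    The counter is refilled at a hit and at a deviation; a bad vertex is charged when it is left. *)
Definition step (s : node) (a b : letter) : node :=
  let m := mode_after (nmode s) a b in
  (m, (move (nvert s) b,
    if m == ord0 then
      if hit (nvert s) (ntgt s) then
        (if ntgt s is 0 then J.-1 else (ntgt s).-1, K)
      else (ntgt s, (ncnt s).-1)
    else (ntgt s,
      if nmode s == ord0 then K
      else if bad m (nvert s) then (ncnt s).-1 else ncnt s))).

(** Only the undisturbed play has to realize the guessed payoffs. After a deviation the sole duty is
    to limit the bad vertices of the culprit. *)
Definition allowed (s : node) (a : letter) : bool :=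
  if nmode s == ord0 then
    [forall i, (lval (nvert s i) <= weight (laut (nvert s i)) a)%O] &&
    (hit (nvert s) (ntgt s) || (0 < ncnt s))
  else bad (nmode s) (nvert s) ==> (0 < ncnt s).

Definition wf (s : node) : bool := (ntgt s < J) && (ncnt s <= K).

Definition legal (s : node) (a b : letter) : bool := sim (mode_after (nmode s) a b) a b.

Definition ok_step (P : node -> Prop) (s : node) : Prop :=
  exists2 a, allowed s a & forall b, legal s a b -> P (step s a b).

(** The greatest fixpoint as the union of all invariants, independent of the iteration that computes
    it. *)
Definition ok (s : node) : Prop :=
  exists2 P : node -> Prop, P s & forall t, P t -> wf t /\ ok_step P t.

Lemma ok_unfold s : ok s -> wf s /\ ok_step ok s.
Proof.
move=> [P Ps h]; have [ws [a la hb]] := h s Ps; split=> //; exists a => // b /hb Pb.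
by exists P.
Qed.

Lemma ok_coind (P : node -> Prop) :
  (forall t, P t -> wf t /\ ok_step (fun t => P t \/ ok t) t) -> forall s, P s -> ok s.
Proof.
move=> h s Ps; exists (fun t => P t \/ ok t); first by left.
move=> t [/h//|/ok_unfold[wt [a la hb]]]; split=> //; exists a => // b /hb; by right.
Qed.

Lemma simxx i a : sim i a a.
Proof. by apply/forallP => p; rewrite eqxx orbT. Qed.

Lemma sim0 a b : sim ord0 a b = (a == b).
Proof.
apply/forallP/eqP => [h|-> p]; last by rewrite (eqxx (p \in b)) orbT.
by apply/setP => p; have := h p; rewrite eqxx /= => /eqP.
Qed.

Lemma sim_ctrl (i : agent) a b : i != ord0 ->
  reflect (forall p, p \notin ctrl i -> (p \in a) = (p \in b)) (sim i a b).
Proof.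
move=> i0; apply: (iffP forallP) => h p; have := h p; rewrite i0 /=.
  by case: (p \in ctrl i) => //= /eqP.
by case: (p \in ctrl i) => //= ->.
Qed.

(** Every variable is outside the control of at least one of two distinct agents, so two different
    culprits would force [a] and [b] to agree everywhere. *)
Lemma sim_inj (i j : agent) a b : i != ord0 -> j != ord0 -> a != b -> sim i a b -> sim j a b -> i = j.
Proof.
move=> i0 j0 ab /(sim_ctrl _ _ i0) hi /(sim_ctrl _ _ j0) hj.
apply/eqP; apply: contraNT ab => /ctrl_disjoint/disjointFr dij.
apply/eqP/setP => p; have [pi|/hi//] := boolP (p \in ctrl i).
by apply: hj; rewrite (dij p pi).
Qed.

Lemma culpritE i a b : sim i a b -> culprit a b = if a == b then ord0 else i.
Proof.
move=> sab; rewrite /culprit; have [<-|ab] := eqVneq a b.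
  by rewrite enum_ordSl /= simxx.
case E: (filter _ _) => [|j s].
  have : i \in [seq i <- enum 'I_(nagents I).+1 | sim i a b] by rewrite mem_filter sab mem_enum.
  by rewrite E.
have : j \in [seq i <- enum 'I_(nagents I).+1 | sim i a b] by rewrite E mem_head.
rewrite mem_filter => /andP[sj _] /=; apply/esym.
apply: (sim_inj _ _ ab sab sj); first by apply: contraNneq ab => e; rewrite -sim0 -e.
by apply: contraNneq ab => e; rewrite -sim0 -e.
Qed.

Lemma culprit_sim i a b : sim i a b -> sim (culprit a b) a b.
Proof. by move=> s; rewrite (culpritE s); case: eqP => // ->; apply: simxx. Qed.

Lemma joint_move_deviate (pi : profile I) i f h :
  valid_profile pi -> i != ord0 -> strategy_of i f ->
  sim i (joint_move pi h) (joint_move (deviate pi i f) h).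
Proof.
move=> vpi i0 vf; apply/(sim_ctrl _ _ i0) => p pi_.
have out g : valid_profile g -> forall j, p \in g j h -> j != i.
  by move=> vg j pj; apply: contraNneq pi_ => <-; apply: (subsetP (vg j h)).
have vdev : valid_profile (deviate pi i f).
  by move=> j; rewrite /deviate; case: eqP => [->|_]; [exact: vf | exact: vpi].
apply/bigcupP/bigcupP => -[j _ pj]; exists j => //; move: pj.
  by move=> /[dup] /out -/(_ vpi) ji; rewrite /deviate (negbTE ji).
by move=> /[dup] /out -/(_ vdev) ji; rewrite /deviate (negbTE ji).
Qed.

(** * Soundness: winning choices yield an equilibrium *)

Section Soundness.
Variables (ch : node -> letter) (u0 : vertex).
Hypothesis chP : forall s, ok s ->
  allowed s (ch s) /\ forall b, legal s (ch s) b -> ok (step s (ch s) b).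
Hypothesis u0_init : forall i, laut (u0 i) = init (objective i) /\ lmeet (u0 i) = \top%O.
Let s0 : node := (ord0, (u0, (0, K))).
Hypothesis ok0 : ok s0.

Let nx (s : node) (b : letter) : node := step s (ch s) b.
Let st (h : seq letter) : node := foldl nx s0 h.

Fixpoint track (w : nat -> letter) (k : nat) : node :=
  if k is k'.+1 then nx (track w k') (w k') else s0.

Lemma track_vert w k i : nvert (track w k) i =
  (run (objective i) w k, (path_meet (objective i) w k, lval (u0 i))).
Proof.
elim: k => [|k IH] /=.
  rewrite -[LHS]/(u0 i); move: (u0_init i); rewrite /laut /lmeet /lval.
  by case: (u0 i) => q [x y] /= [-> ->].
by rewrite /nvert /= ffunE IH.
Qed.

(** A common choice of letters is split among the agents; the controlled sets cover all variables,
    so the shares reassemble to the chosen letter. *)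
Definition choice_profile : profile I := fun i h => ch (st h) :&: ctrl i.

Lemma choice_profile_valid : valid_profile choice_profile.
Proof. by move=> i h; apply: subsetIr. Qed.

Lemma joint_choice h : joint_move choice_profile h = ch (st h).
Proof. by rewrite /joint_move /choice_profile -big_distrr /= ctrl_cover setIT. Qed.

Lemma track_history (P : profile I) k : st (history P k) = track (outcome P) k.
Proof. by elim: k => //= k IH; rewrite /st foldl_rcons -/(st _) IH. Qed.

Lemma follow_track w : (forall k, w k = ch (track w k)) ->
  forall k, ok (track w k) /\ nmode (track w k) = ord0.
Proof.
move=> hw; elim=> [//|k [okk mk]] /=; rewrite /nx hw.
have mk' : mode_after (nmode (track w k)) (ch (track w k)) (ch (track w k)) = ord0.
  by rewrite /mode_after mk eqxx (culpritE (simxx ord0 _)) eqxx.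
split; last exact: mk'.
by apply: (chP okk).2; rewrite /legal simxx.
Qed.

(** The counter forces a hit of the current target after finitely many steps, and each hit passes to
    the next target of the cycle. Hence every pair [(i, y)] is hit infinitely often. *)
Lemma follow_value w i : (forall k, w k = ch (track w k)) ->
  (lval (u0 i) <= value (objective i) w)%O.
Proof.
move=> hw; have okw := follow_track hw.
have all k : allowed (track w k) (w k) by rewrite hw; apply: (chP (okw k).1).1.
have st0 k : track w k.+1 = (ord0, (move (nvert (track w k)) (w k),
    if hit (nvert (track w k)) (ntgt (track w k)) then
      (if ntgt (track w k) is 0 then J.-1 else (ntgt (track w k)).-1, K)
    else (ntgt (track w k), (ncnt (track w k)).-1))).
  rewrite /= /nx /step; have := (okw k.+1).2; rewrite /= /nmode /= => ->.
  by rewrite eqxx.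
apply/le_valueP; split=> [k|y m nle].
  have := all k; rewrite /allowed (okw k).2 eqxx => /andP[/forallP/(_ i)].
  by rewrite track_vert.
pose h k := hit (nvert (track w k)) (ntgt (track w k)).
pose j k := ntgt (track w k).
have next_hit k : exists2 k', k <= k' & h k' /\ j k' = j k.
  have [c] := ubnP (ncnt (track w k)); elim: c k => // c IH k; rewrite ltnS => ck.
  have [hk|nh] := boolP (h k); first by exists k.
  have := all k; rewrite /allowed (okw k).2 eqxx -/(h k) (negbTE nh) /= => /andP[_ c0].
  have [|k' kk' [hk' jk']] := IH k.+1.
    by rewrite st0 -/(h k) (negbTE nh) /ncnt /= -/(ncnt _); lia.
  exists k'; first exact: ltnW; split=> //; rewrite jk'.
  by rewrite /j st0 -/(h k) (negbTE nh).
have jS k : h k -> j k.+1 = if j k is 0 then J.-1 else (j k).-1.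
  by move=> hk; rewrite /j st0 -/(h k) hk.
have jJ k : j k < J by have /ok_unfold[/andP[]] := (okw k).1.
have hit0 k : exists2 k', k <= k' & h k' /\ j k' = 0.
  have [c] := ubnP (j k); elim: c k => // c IH k; rewrite ltnS => ck.
  have [k1 kk1 [hk1 jk1]] := next_hit k.
  case E: (j k1) (jS _ hk1) => [|d] jk1S; first by exists k1.
  have [|k2 k12 h2] := IH k1.+1; first by rewrite jk1S /=; move: E ck; rewrite jk1; lia.
  by exists k2 => //; lia.
(* A hit of target 0 wraps around to [J.-1], and each of [d] further hits descends by one. *)
have hit_all d k : d < J -> exists2 k', k <= k' & h k' /\ j k' = J.-1 - d.
  elim: d k => [|d IH] k dJ.
    have [k1 kk1 [h1 j1]] := hit0 k; have [k2 k12 [h2 j2]] := next_hit k1.+1.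
    exists k2; first lia; split=> //; rewrite j2 jS // j1; lia.
  have [|k1 kk1 [h1 j1]] := IH k; first lia.
  have [k2 k12 [h2 j2]] := next_hit k1.+1; exists k2; first lia.
  by split=> //; rewrite j2 jS // j1; case E: (J.-1 - d) => [|e]; lia.
have iyT : (i, y) \in targets by apply/allpairsP; exists (i, y); rewrite !mem_enum.
have tJ : index (i, y) targets < J by rewrite index_mem.
have [|k mk [hk jk]] := @hit_all (J.-1 - index (i, y) targets) m; first lia.
exists k => //; move: hk; rewrite /h -/(j k) jk.
have -> : J.-1 - (J.-1 - index (i, y) targets) = index (i, y) targets by lia.
by rewrite /hit nth_index //= track_vert /lval /laut /= -/(lval _) (negbTE nle).
Qed.

(** After a departure the mode stays [i] and the counter never grows. Every bad vertex costs a unit,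
    so there are finitely many of them, which is the criterion of [value_leP]. *)
Lemma deviate_value w i : i != ord0 -> (forall k, sim i (ch (track w k)) (w k)) ->
  (exists k, w k != ch (track w k)) -> (value (objective i) w <= lval (u0 i))%O.
Proof.
move=> i0 hw [k0 nk0].
have mS k : nmode (track w k.+1) = mode_after (nmode (track w k)) (ch (track w k)) (w k) by [].
have inv k : ok (track w k) /\ (nmode (track w k) = ord0 \/ nmode (track w k) = i).
  elim: k => [|k [okk mk]]; first by split=> //; left.
  split; first apply: (chP okk).2; rewrite ?mS /legal /mode_after.
    by case: mk => ->; rewrite ?eqxx ?(negbTE i0) //; apply: culprit_sim (hw k).
  case: mk => ->; rewrite ?eqxx ?(negbTE i0); last by right.
  by rewrite (culpritE (hw k)); case: eqP; [left | right].
have mi k : k0 < k -> nmode (track w k) = i.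
  elim: k => // k IH; rewrite ltnS leq_eqVlt mS => /orP[/eqP<-|/IH->]; last first.
    by rewrite /mode_after (negbTE i0).
  rewrite /mode_after; have [_ [->|->]] := inv k0; last by rewrite (negbTE i0).
  by rewrite eqxx (culpritE (hw k0)) eq_sym (negbTE nk0).
have cS k : k0 < k -> ncnt (track w k.+1) =
    if bad i (nvert (track w k)) then (ncnt (track w k)).-1 else ncnt (track w k).
  by move=> /mi mk; rewrite /= /nx /step /mode_after mk (negbTE i0) /ncnt /= (negbTE i0).
suff [m hm] : exists m, forall k, m <= k -> ~~ bad i (nvert (track w k)).
  apply/value_leP; exists m => k mk; have := hm k mk.
  by rewrite negbK track_vert.
have [c] := ubnP (ncnt (track w k0.+1)); have : k0 < k0.+1 by [].
elim: c {2 3}k0.+1 => // c IH k kk; rewrite ltnS => ck.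
have [none|/existsNP[k1 /not_implyP[kk1 b1]]] :=
  pselect (forall k', k <= k' -> ~~ bad i (nvert (track w k'))); first by exists k.
have {}b1 : bad i (nvert (track w k1)) by apply: contraT => /b1.
have c1 : 0 < ncnt (track w k1).
  have := (chP (inv k1).1).1; rewrite /allowed mi; last exact: leq_trans kk1.
  by rewrite (negbTE i0) b1.
have le1 : ncnt (track w k1) <= ncnt (track w k).
  rewrite -(subnKC kk1); elim: (k1 - k) => [|d IHd]; first by rewrite addn0.
  rewrite addnS cS; last by lia.
  by apply: leq_trans IHd; case: ifP => // _; apply: leq_pred.
apply: (IH k1.+1); first by lia.
by rewrite cS ?b1; lia.
Qed.

(** The guess [lval (u0 i)] lies between the two payoffs if the deviation shows in the play; if it
    never shows, the outcome and hence the payoff are the same. *)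
Lemma choice_profile_solution :
  (threshold I <= lval (u0 ord0))%O -> solution choice_profile.
Proof.
move=> thr; set w := outcome choice_profile.
have hw k : w k = ch (track w k) by rewrite -track_history -joint_choice.
split; first exact: choice_profile_valid.
  by apply: le_trans thr _; apply: follow_value.
move=> i i0 f vf; set w' := outcome (deviate choice_profile i f).
have hw' k : sim i (ch (track w' k)) (w' k).
  rewrite -track_history -joint_choice.
  by apply: joint_move_deviate => //; apply: choice_profile_valid.
have [dev|nodev] := pselect (exists k, w' k != ch (track w' k)).
  by apply: le_trans (deviate_value i0 hw' dev) _; apply: follow_value.
have eq' k : w' k = ch (track w' k).
  by apply/eqP; apply: contraT => ne; case: nodev; exists k.
suff ww : forall k, track w' k = track w k.
  have -> // : payoff i (deviate choice_profile i f) = payoff i choice_profile.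
  rewrite /payoff -/w -/w'; suff -> : w' = w by [].
  by apply/funext => k; rewrite hw eq' ww.
by elim=> //= k IH; rewrite eq' IH -hw.
Qed.
End Soundness.

(** Each strict inclusion adds an element, so [n] strict ones fill all of [T]. *)
Lemma chain_stable (T : finType) (Y : nat -> {set T}) n :
  (forall k, k < n -> Y k \subset Y k.+1) -> #|T| <= n ->
  Y n = setT \/ exists2 k, k < n & Y k = Y k.+1.
Proof.
move=> incr le; have [ex|none] := pselect (exists2 k, k < n & Y k = Y k.+1); first by right.
left; apply/eqP; rewrite eqEcard subsetT cardsT /=; apply: leq_trans le _.
suff h k : k <= n -> k <= #|Y k| by apply: h.
elim: k => // k IH kn; apply: leq_ltn_trans (IH (ltnW kn)) _; apply: proper_card.
by rewrite properEneq incr // andbT; apply/eqP => e; case: none; exists k.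
Qed.

(** The same choices win with a spare unit: the invariant consists of winning nodes with their
    counter raised by one. *)
Lemma ok_mono i u j k : i != ord0 -> k < K ->
  ok (i, (u, (j, k))) -> ok (i, (u, (j, k.+1))).
Proof.
move=> i0 kK oku.
pose P (t : node) := exists v l, [/\ t = (i, (v, (j, l.+1))), l < K & ok (i, (v, (j, l)))].
apply: (@ok_coind P); last by exists u, k.
move=> _ [v [l [-> lK /ok_unfold[/andP[jJ _] [a al ha]]]]].
split; [by apply/andP | rewrite /ntgt /= in jJ].
exists a => [|b lb]; first by rewrite /allowed /= (negbTE i0) implybT.
have := ha b lb; move: al; rewrite /allowed /step /mode_after /nmode /nvert /ncnt /ntgt /= !(negbTE i0).
case: (bad i v) => /= l0 okb; left; last by exists (move v b), l.
by exists (move v b), l.-1; rewrite prednK //; split=> //; apply: ltnW.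
Qed.

(** * Completeness: an equilibrium yields a winning initial node *)

Section Completeness.
Variable pi : profile I.
Hypothesis pi_sol : solution pi.

Let u0 : vertex := [ffun i => (init (objective i), (\top%O, payoff i pi))].
Let vh (h : seq letter) : vertex := foldl move u0 h.

Lemma vh_word (w : nat -> letter) k i : vh (mkseq w k) i =
  (run (objective i) w k, (path_meet (objective i) w k, payoff i pi)).
Proof.
elim: k => [|k IH]; first by rewrite /vh /= ffunE.
by rewrite mkseqS /vh foldl_rcons -/(vh _) ffunE IH.
Qed.

Definition conform (i : agent) (h : seq letter) : Prop :=
  forall k, k < size h -> sim i (joint_move pi (take k h)) (nth set0 h k).

Lemma conform_rcons i h b : conform i h -> sim i (joint_move pi h) b -> conform i (rcons h b).
Proof.
move=> ch sb k; rewrite size_rcons ltnS leq_eqVlt nth_rcons -cats1 => /orP[/eqP->|kh].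
  by rewrite take_size_cat // ltnn eqxx.
by rewrite takel_cat ?(ltnW kh) // kh; apply: ch.
Qed.

(** Replaying its share of [w] by the clock alone is a strategy of [i], and outside [ctrl i] the
    profile already agrees with [w]. So [w] is the outcome of a unilateral deviation. *)
Lemma deviation_value i (w : nat -> letter) : i != ord0 ->
  (forall k, sim i (joint_move pi (mkseq w k)) (w k)) ->
  (value (objective i) w <= payoff i pi)%O.
Proof.
move=> i0 cw; have [vpi _ ne] := pi_sol.
pose f (h : seq letter) := w (size h) :&: ctrl i.
have vf : strategy_of i f by move=> h; apply: subsetIr.
suff e : outcome (deviate pi i f) = w by have := ne i i0 f vf; rewrite /payoff e.
have mv k : joint_move (deviate pi i f) (mkseq w k) = w k.
  apply/setP => p; have [pi_|pni] := boolP (p \in ctrl i); last first.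
    have /(sim_ctrl _ _ i0)/(_ p pni) := joint_move_deviate (mkseq w k) vpi i0 vf.
    by have /(sim_ctrl _ _ i0)/(_ p pni) -> := cw k => ->.
  apply/bigcupP/idP => [[j _]|pw].
    rewrite /deviate; case: eqP => [_|/eqP/ctrl_disjoint/disjointFl/(_ pi_) pj].
      by rewrite /f inE size_mkseq => /andP[].
    by move=> /(subsetP (vpi j _)); rewrite pj.
  by exists i => //; rewrite /deviate eqxx /f inE size_mkseq pw.
have hist k : history (deviate pi i f) k = mkseq w k.
  by elim: k => //= k IH; rewrite IH mv mkseqS.
by apply/funext => k; rewrite /outcome hist mv.
Qed.

Lemma history_mkseq k : history pi k = mkseq (outcome pi) k.
Proof. by elim: k => //= k IH; rewrite mkseqS -IH. Qed.

(* Let [Y k] be the vertices from which [k] bad visits suffice.  The chain [Y]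
   stabilizes at some [k < K]; from a vertex outside [Y k], any strategy of the
   others lets [i] pass through a bad vertex and stay outside [Y k], hence forever. *)
Lemma ok_deviated i h j : i != ord0 -> conform i h -> j < J -> ok (i, (vh h, (j, K))).
Proof.
move=> i0 ch jJ; apply: contrapT => nok.
pose Y k := [set u | `[< ok (i, (u, (j, k))) >]].
have inY k u : reflect (ok (i, (u, (j, k)))) (u \in Y k) by rewrite inE; apply: asboolP.
have [|YT|[k kK eY]] := @chain_stable vertex Y K _ vertex_leK.
- by move=> k kK; apply/subsetP => u /inY oku; apply/inY/ok_mono.
- by apply/nok/inY; rewrite YT inE.
have incr d : k <= d -> d <= K -> Y k \subset Y d.
  elim: d => [|d IH]; first by rewrite leqn0 => /eqP->.
  rewrite leq_eqVlt ltnS => /orP[/eqP->//|kd] dK; apply: subset_trans (IH kd (ltnW dK)) _.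
  by apply/subsetP => u /inY oku; apply/inY/ok_mono.
have nY : vh h \notin Y k.
  by apply/ssrbool.negP => /(subsetP (incr K (ltnW kK) (leqnn _)))/inY.
(* Without such an extension, following [pi] wins with [k.+1] units: a bad vertex could only be left
   into [Y k], where the remaining [k] units suffice. Then [vh h1] is in [Y k.+1], which equals
   [Y k]. *)
have key h1 : conform i h1 -> vh h1 \notin Y k -> exists h2,
    [/\ conform i (h1 ++ h2), vh (h1 ++ h2) \notin Y k &
      exists2 m, size h1 <= m < size (h1 ++ h2) & bad i (vh (take m (h1 ++ h2)))].
  move=> c1 n1; apply: contrapT => none; case/ssrbool.negP: (n1); rewrite eY; apply/inY.
  pose P (t : node) := exists h2, [/\ t = (i, (vh (h1 ++ h2), (j, k.+1))),
    conform i (h1 ++ h2) & vh (h1 ++ h2) \notin Y k].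
  apply: (@ok_coind P); last first.
    by exists [::]; rewrite cats0.
  move=> _ [h2 [-> c2 n2]]; split; first by apply/andP.
  exists (joint_move pi (h1 ++ h2)) => [|b].
    by rewrite /allowed /= (negbTE i0) implybT.
  rewrite /legal /step /mode_after /nmode /nvert /ncnt /ntgt /= !(negbTE i0) => sb.
  have -> : move (vh (h1 ++ h2)) b = vh (h1 ++ rcons h2 b) by rewrite -rcons_cat /vh foldl_rcons.
  have [inYb|ninY] := boolP (vh (h1 ++ rcons h2 b) \in Y k).
    by right; case: ifP => _; apply/inY; rewrite -?eY.
  have c3 : conform i (h1 ++ rcons h2 b) by rewrite -rcons_cat; apply: conform_rcons.
  case: ifP => bd; last by left; exists (rcons h2 b).
  case: none; exists (rcons h2 b); split=> //; exists (size (h1 ++ h2)).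
    by rewrite !size_cat size_rcons leq_addr addnS ltnS leqnn.
  by rewrite -rcons_cat -cats1 take_size_cat.
have /choice[nx nxP] : forall h1, exists h2, conform i h1 -> vh h1 \notin Y k ->
    [/\ conform i (h1 ++ h2), vh (h1 ++ h2) \notin Y k &
      exists2 m, size h1 <= m < size (h1 ++ h2) & bad i (vh (take m (h1 ++ h2)))].
  move=> h1.
  have [c1|nc] := pselect (conform i h1); last by exists [::].
  have [n1|nn] := boolP (vh h1 \notin Y k); last by exists [::].
  by have [h2 hh2] := key h1 c1 n1; exists h2.
pose G n := iter n (fun g => g ++ nx g) h.
have GP n : conform i (G n) /\ vh (G n) \notin Y k.
  by elim: n => // n [cn nn]; have [] := nxP _ cn nn.
have Gbad n : exists2 m, size (G n) <= m < size (G n.+1) & bad i (vh (take m (G n.+1))).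
  by have [cn nn] := GP n; have [] := nxP _ cn nn.
have Gsz n : n <= size (G n).
  by elim: n => // n IH; have [m /andP[]] := Gbad n; lia.
(* The limit of the growing histories: [G l.+1] has more than [l] letters, so position [l] is final
   there and the default is not reached. *)
pose w l := nth set0 (G l.+1) l.
have Gpre n d : take (size (G n)) (G (n + d)) = G n.
  elim: d => [|d IH]; first by rewrite addn0 take_size.
  have le : size (G n) <= size (G (n + d)) by rewrite -{1}IH size_take; case: ltnP; lia.
  by rewrite addnS /= takel_cat.
have Gnth n l : l < size (G n) -> nth set0 (G n) l = w l.
  move=> ln; rewrite /w; have le (n1 n2 : nat) : n1 <= n2 -> l < size (G n1) ->
      nth set0 (G n1) l = nth set0 (G n2) l.
    by move=> le ll; rewrite -(Gpre n1 (n2 - n1)) subnKC // nth_take.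
  by case: (leqP n l.+1) => [/le|/ltnW/le e]; [apply | rewrite e //; apply: Gsz].
have Gtake n l : l <= size (G n) -> take l (G n) = mkseq w l.
  move=> ln; apply: (@eq_from_nth _ set0); first by rewrite size_mkseq size_takel.
  move=> l'; rewrite size_takel // => ll'; rewrite nth_take // nth_mkseq //.
  by apply: Gnth; apply: leq_trans ln.
have cw l : sim i (joint_move pi (mkseq w l)) (w l).
  have ll := Gsz l.+1; have [cl _] := GP l.+1.
  by rewrite -(Gtake l.+1) ?(ltnW ll) //; apply: cl.
have /value_leP[m hm] := deviation_value i0 cw.
have [l /andP[ml lm] bl] := Gbad m.
have := hm l (leq_trans (Gsz m) ml).
by move: bl; rewrite (Gtake m.+1) ?(ltnW lm) // /bad vh_word => /negbTE->.
Qed.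

Lemma completeness : exists u : vertex,
  [/\ forall i, laut (u i) = init (objective i) /\ lmeet (u i) = \top%O,
      (threshold I <= lval (u ord0))%O & ok (ord0, (u, (0, K)))].
Proof.
have [vpi thr _] := pi_sol; exists u0; split.
- by move=> i; rewrite ffunE.
- by rewrite ffunE.
(* One step of the attractor of target [j] in the graph of the vertices and edges that occur on the
   outcome. Any occurrence [m] of [u] may serve, so distances are bounded by the number of vertices
   even where the waits on the outcome are longer. *)
pose F j (X : {set vertex}) := [set u | `[< exists m, vh (history pi m) = u /\
  (hit u j || (vh (history pi m.+1) \in X)) >]].
have inF j (X : {set vertex}) u : reflect (exists m, vh (history pi m) = u /\
    (hit u j || (vh (history pi m.+1) \in X))) (u \in F j X).
  by rewrite inE; apply: asboolP.
have Fmono j : {homo F j : X Y / X \subset Y}.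
  move=> X Y XY; apply/subsetP => u /inF[m [e h]]; apply/inF; exists m; split=> //.
  by case/orP: h => [->//|/(subsetP XY)->]; rewrite orbT.
have val (i : agent) : (forall k, (payoff i pi <= weight (run (objective i) (outcome pi) k) (outcome pi k))%O) /\
   (forall y m, ~~ (payoff i pi <= y)%O ->
     exists2 k, m <= k & ~~ (acc (run (objective i) (outcome pi) k) <= y)%O).
  by apply/le_valueP.
have vhE m i : vh (history pi m) i = (run (objective i) (outcome pi) m,
   (path_meet (objective i) (outcome pi) m, payoff i pi)).
  by rewrite history_mkseq vh_word.
have hits j m : exists2 k, m <= k & hit (vh (history pi k)) j.
  pose t := nth (ord0, \top%O) targets j.
  have [le|nle] := boolP (payoff t.1 pi <= t.2)%O.
    by exists m => //; rewrite /hit vhE le.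
  have [k mk hk] := (val t.1).2 t.2 m nle; exists k => //.
  by rewrite /hit -/t vhE /laut /= hk orbT.
have reach j m : vh (history pi m) \in fixset (F j).
  have [k mk hk] := hits j m; move: mk; rewrite -(fixsetK (Fmono j)).
  rewrite leq_eqVlt => /orP[/eqP->|]; first by apply/inF; exists k; rewrite hk.
  move=> /subnKC; move: (k - m.+1) => d; elim: d m => [|d IH] m e.
    apply/inF; exists m; split=> //; rewrite -(fixsetK (Fmono j)).
    by apply/orP; right; apply/inF; exists k; move: e; rewrite addn0 => ->; rewrite hk.
  apply/inF; exists m; split=> //; rewrite -(fixsetK (Fmono j)).
  by apply/orP; right; apply: IH; lia.
have reachK j m : vh (history pi m) \in iter K.+1 (F j) set0.
  by rewrite -(subnK (leqW vertex_leK)) iterD (fixsetKn (Fmono j)).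
have J0 : 0 < J by rewrite /J size_allpairs -!cardE card_ord muln_gt0 /=; apply/card_gt0P; exists \top%O.
(* Counter [k] goes with iterate [k.+1]: the first iterate holds the vertices that hit at once and
   need no unit. *)
pose P (t : node) := exists u j k, [/\ t = (ord0, (u, (j, k))), j < J, k <= K &
  u \in iter k.+1 (F j) set0].
apply: (@ok_coind P); last by exists u0, 0, K; split=> //; apply: (reachK 0 0).
move=> _ [u [j [k [-> jJ kK]]]]; rewrite iterS => /inF[m [<- hm]].
split; first by apply/andP.
exists (outcome pi m) => [|b].
  rewrite /allowed eqxx; apply/andP; split.
    by apply/forallP => i; rewrite /nvert vhE; apply: (val i).1.
  by case/orP: hm => [->//|]; case: (k) => [|l]; rewrite /= ?inE // orbT.
rewrite /legal /mode_after eqxx => lb; rewrite /step /mode_after eqxx.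
have [c0|c0] := eqVneq (culprit (outcome pi m) b) ord0.
  move: lb; rewrite c0 sim0 => /eqP <-.
  have -> : move (nvert (ord0, (vh (history pi m), (j, k)))) (outcome pi m) = vh (history pi m.+1).
    by rewrite /= /vh foldl_rcons.
  left; rewrite /nvert /ntgt /ncnt /=.
  have [hj|nj] := boolP (hit _ _).
    have jd : (if j is 0 then J.-1 else j.-1) < J by case: (j) jJ; lia.
    by exists (vh (history pi m.+1)), (if j is 0 then J.-1 else j.-1), K; split=> //; apply: reachK.
  move: hm; rewrite (negbTE nj) /=; case: k kK => [|k] kK hm; first by rewrite inE in hm.
  by exists (vh (history pi m.+1)), j, k; split=> //; exact: ltnW.
(* A deviation. All earlier letters are those of the outcome, so the history conforms for the
   culprit, and [ok_deviated] applies with the counter just refilled. *)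
right; rewrite /nvert /ntgt /= .
have -> : move (vh (history pi m)) b = vh (rcons (history pi m) b) by rewrite /vh foldl_rcons.
apply: ok_deviated => //; apply: conform_rcons => // l.
rewrite history_mkseq size_mkseq => lm; rewrite nth_mkseq //.
have -> : take l (mkseq (outcome pi) m) = history pi l.
  rewrite history_mkseq /mkseq -map_take take_iota; congr (map _ (iota 0 _)).
  exact/minn_idPl/ltnW.
exact: simxx.
Qed.
End Completeness.

End Arena.

(** * The algorithm on encodings *)

Definition tnot (b : tree) : tree := tif b Nil (Cons Nil Nil).
Definition tand (b c : tree) : tree := tif b c Nil.
Definition tor (b c : tree) : tree := tif b b c.
Definition tall (p : tree -> tree) (l : tree) : tree := tnot (tfilter (fun a => tnot (p a)) l).
Definition tmem (x l : tree) : tree := tfilter (fun y => teq x y) l.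
Definition tindex (l x : tree) : tree := thd (tfilter (fun k => teq (lk l k) x) (tiota l)).
Definition tunary (l : tree) : tree := tmap (fun=> Nil) l.

Lemma tb_not b : tb (tnot b) = ~~ tb b. Proof. by case: b. Qed.
Lemma tb_and b c : tb (tand b c) = tb b && tb c. Proof. by case: b. Qed.
Lemma tb_or b c : tb (tor b c) = tb b || tb c. Proof. by case: b. Qed.
Lemma tb_tre s : tb (tre s) = (s != [::]). Proof. by case: s. Qed.
Lemma tb_filter p l : tb (tfilter p l) = has (fun a => tb (p a)) (lst l).
Proof. by rewrite tb_tre has_filter. Qed.
Lemma tb_all p l : tb (tall p l) = all (fun a => tb (p a)) (lst l).
Proof.
rewrite tb_not tb_filter -all_predC; apply: eq_all => a /=.
by rewrite tb_not negbK.
Qed.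
Lemma tb_mem x l : tb (tmem x l) = (x \in lst l).
Proof. by rewrite tb_filter -has_pred1; apply: eq_has => y; rewrite /= tb_eq eq_sym. Qed.

Ltac pt_named ::= first
  [ simple apply pt_cat | simple apply pt_flat | simple apply pt_lk | simple apply pt_iota
  | simple apply pt_eq
  | simple apply pt_map; [unfold ptime2; cbv beta | ]
  | simple apply pt_filter; [unfold ptime2; cbv beta | ]
  | match goal with H : ptime ?e |- ptime (fun x => ?e (@?g x)) => simple apply (@pt_comp e g H) end ].

Lemma pt_not b : ptime b -> ptime (fun x => tnot (b x)).
Proof. by move=> *; rewrite /tnot; pt. Qed.
Lemma pt_and b c : ptime b -> ptime c -> ptime (fun x => tand (b x) (c x)).
Proof. by move=> *; rewrite /tand; pt. Qed.
Lemma pt_or b c : ptime b -> ptime c -> ptime (fun x => tor (b x) (c x)).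
Proof. by move=> *; rewrite /tor; pt. Qed.
Lemma pt_all p l : ptime2 p -> ptime l -> ptime (fun e => tall (fun a => p a e) (l e)).
Proof.
move=> hp hl; rewrite /tall; apply: pt_not.
by apply: (@pt_filter (fun a e => tnot (p a e))) => //; apply: pt_not.
Qed.
Lemma pt_mem x l : ptime x -> ptime l -> ptime (fun e => tmem (x e) (l e)).
Proof. by move=> *; rewrite /tmem; pt. Qed.
Lemma pt_index l x : ptime l -> ptime x -> ptime (fun e => tindex (l e) (x e)).
Proof. by move=> *; rewrite /tindex; pt. Qed.
Lemma pt_unary l : ptime l -> ptime (fun e => tunary (l e)).
Proof. by move=> *; rewrite /tunary; pt. Qed.

Ltac pt_lib := first
  [ simple apply pt_cat | simple apply pt_flat | simple apply pt_lk | simple apply pt_iota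
  | simple apply pt_eq | simple apply pt_not | simple apply pt_and | simple apply pt_or
  | simple apply pt_mem | simple apply pt_index | simple apply pt_unary
  | simple apply pt_map; [unfold ptime2; cbv beta | ]
  | simple apply pt_filter; [unfold ptime2; cbv beta | ]
  | simple apply pt_all; [unfold ptime2; cbv beta | ]
  | match goal with H : ptime ?e |- ptime (fun x => ?e (@?g x)) => simple apply (@pt_comp e g H) end ].
Ltac pt_named ::= pt_lib.

(* The environment [e] of the algorithm is the encoded problem paired with the
   list of all vertices. *)
Definition tleq (e x y : tree) : tree := lk (lk (thd (thd (thd e))) x) y.
Definition tmeet (e x y : tree) : tree := lk (lk (thd (ttl (thd (thd e)))) x) y.
Definition tthreshold (e : tree) : tree := thd (ttl (thd e)).
Definition tautomata (e : tree) : tree := ttl (ttl (thd e)).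
Definition tagents (e : tree) : tree := tiota (tautomata e).
Definition tvalues (e : tree) : tree := tiota (thd (thd (thd e))).
Definition tctrl (e i : tree) : tree := thd (lk (tautomata e) i).
Definition tinit (e i : tree) : tree := thd (ttl (lk (tautomata e) i)).
Definition trow (e i q : tree) : tree := lk (ttl (ttl (lk (tautomata e) i))) q.
Definition tacc (e i q : tree) : tree := thd (trow e i q).
Definition tcell (e i q b : tree) : tree :=
  ttl (thd (tfilter (fun c => teq (thd c) b) (ttl (trow e i q)))).
(** Read off the transition row of the first state of the system's automaton; there is a first state
    because there is an initial one. *)
Definition tletters (e : tree) : tree :=
  tmap thd (ttl (thd (ttl (ttl (thd (tautomata e)))))).
Definition ttargets (e : tree) : tree :=
  tflat (tmap (fun i => tmap (fun y => Cons i y) (tvalues e)) (tagents e)).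

Lemma pt_tleq e x y : ptime e -> ptime x -> ptime y -> ptime (fun z => tleq (e z) (x z) (y z)).
Proof. by move=> *; rewrite /tleq; pt. Qed.
Lemma pt_tmeet e x y : ptime e -> ptime x -> ptime y -> ptime (fun z => tmeet (e z) (x z) (y z)).
Proof. by move=> *; rewrite /tmeet; pt. Qed.
Lemma pt_tautomata e : ptime e -> ptime (fun z => tautomata (e z)).
Proof. by move=> *; rewrite /tautomata; pt. Qed.
Lemma pt_tthreshold e : ptime e -> ptime (fun z => tthreshold (e z)).
Proof. by move=> *; rewrite /tthreshold; pt. Qed.
Ltac pt_named ::= first [simple apply pt_tleq | simple apply pt_tmeet | simple apply pt_tautomata
  | simple apply pt_tthreshold | pt_lib].
Lemma pt_tagents e : ptime e -> ptime (fun z => tagents (e z)).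
Proof. by move=> *; rewrite /tagents; pt. Qed.
Lemma pt_tvalues e : ptime e -> ptime (fun z => tvalues (e z)).
Proof. by move=> *; rewrite /tvalues; pt. Qed.
Lemma pt_tctrl e i : ptime e -> ptime i -> ptime (fun z => tctrl (e z) (i z)).
Proof. by move=> *; rewrite /tctrl; pt. Qed.
Lemma pt_tinit e i : ptime e -> ptime i -> ptime (fun z => tinit (e z) (i z)).
Proof. by move=> *; rewrite /tinit; pt. Qed.
Lemma pt_trow e i q : ptime e -> ptime i -> ptime q -> ptime (fun z => trow (e z) (i z) (q z)).
Proof. by move=> *; rewrite /trow; pt. Qed.
Lemma pt_tletters e : ptime e -> ptime (fun z => tletters (e z)).
Proof. by move=> *; rewrite /tletters; pt. Qed.

Ltac pt_input := first [simple apply pt_tleq | simple apply pt_tmeet | simple apply pt_tautomata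
  | simple apply pt_tthreshold | simple apply pt_tagents | simple apply pt_tvalues
  | simple apply pt_tctrl | simple apply pt_tinit | simple apply pt_trow
  | simple apply pt_tletters | pt_lib].
Ltac pt_named ::= pt_input.

Lemma pt_tacc e i q : ptime e -> ptime i -> ptime q -> ptime (fun z => tacc (e z) (i z) (q z)).
Proof. by move=> *; rewrite /tacc; pt. Qed.
Lemma pt_tcell e i q b : ptime e -> ptime i -> ptime q -> ptime b ->
  ptime (fun z => tcell (e z) (i z) (q z) (b z)).
Proof. by move=> *; rewrite /tcell; pt. Qed.
Lemma pt_ttargets e : ptime e -> ptime (fun z => ttargets (e z)).
Proof. by move=> *; rewrite /ttargets; pt. Qed.

(** * The safety game and the answer as functions on trees *)

Definition tlval (u i : tree) : tree := ttl (ttl (lk u i)).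
Definition tmove1 (e i b s : tree) : tree :=
  Cons (thd (tcell e i (thd s) b))
    (Cons (tmeet e (thd (ttl s)) (ttl (tcell e i (thd s) b))) (ttl (ttl s))).
Definition tmove (e u b : tree) : tree := tmap (fun i => tmove1 e i b (lk u i)) (tagents e).
(** Agents are unary numbers and [ord0] is [Nil], so [i] itself is the test [i != ord0]; counters
    are likewise their own positivity test. *)
Definition tsim (e i a b : tree) : tree :=
  tall (fun p => tor (tand i (lk (tctrl e i) p)) (teq (lk a p) (lk b p)))
    (tiota (tctrl e i)).
Definition tculprit (e a b : tree) : tree := thd (tfilter (fun i => tsim e i a b) (tagents e)).
Definition tbad (e i u : tree) : tree :=
  tnot (tleq e (tmeet e (thd (ttl (lk u i))) (tacc e i (thd (lk u i)))) (tlval u i)).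
Definition thit (e u j : tree) : tree :=
  let t := lk (ttargets e) j in
  tor (tleq e (tlval u (thd t)) (ttl t))
    (tnot (tleq e (tacc e (thd t) (thd (lk u (thd t)))) (ttl t))).
Definition tmode (e m a b : tree) : tree := tif m m (tculprit e a b).
Definition tstep (e s a b : tree) : tree :=
  let m := thd s in let u := thd (ttl s) in
  let j := thd (ttl (ttl s)) in let k := ttl (ttl (ttl s)) in
  let m' := tmode e m a b in
  Cons m' (Cons (tmove e u b)
    (tif m' (Cons j (tif m (tif (tbad e m' u) (ttl k) k) (tunary (ttl e))))
      (tif (thit e u j)
        (Cons (tif j (ttl j) (ttl (tunary (ttargets e)))) (tunary (ttl e)))
        (Cons j (ttl k))))).
Definition tallowed (e s a : tree) : tree :=
  let m := thd s in let u := thd (ttl s) in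
  let j := thd (ttl (ttl s)) in let k := ttl (ttl (ttl s)) in
  tif m (tor (tnot (tbad e m u)) k)
    (tand (tall (fun i => tleq e (tlval u i) (ttl (tcell e i (thd (lk u i)) a))) (tagents e))
      (tor (thit e u j) k)).
Definition tgood (e x s a : tree) : tree :=
  tand (tallowed e s a)
    (tall (fun b => tor (tnot (tsim e (tmode e (thd s) a b) a b)) (tmem (tstep e s a b) x))
      (tletters e)).
Definition tchoices (e x s : tree) : tree := tfilter (fun a => tgood e x s a) (tletters e).
(** The extra item in front of the vertex list makes the counters range from 0 to [K] inclusive. *)
Definition tnodes (e : tree) : tree :=
  tflat (tmap (fun m => tflat (tmap (fun u => tflat (tmap (fun j => tmap (fun k =>
    Cons m (Cons u (Cons j k))) (tiota (Cons Nil (ttl e)))) (tiota (ttargets e)))) (ttl e)))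
    (tagents e)).
Definition tok (e : tree) : tree := tgfp (fun x s => tchoices e x s) (tnodes e).
(** The appended letters supply an output at losing nodes as well: a transducer must be total. *)
Definition tchoice (e s : tree) : tree := thd (tcat (tchoices e (tok e) s) (tletters e)).
Definition tstart (e u : tree) : tree := Cons Nil (Cons u (Cons Nil (tunary (ttl e)))).
(** The encoding does not single out the top element, so it is recognized as being above every
    value. *)
Definition tinitial (e u : tree) : tree :=
  tall (fun i => tand (teq (thd (lk u i)) (tinit e i))
    (tall (fun y => tleq e y (thd (ttl (lk u i)))) (tvalues e))) (tagents e).
Definition tcandidates (e : tree) : tree :=
  tfilter (fun u => tand (tand (tinitial e u) (tleq e (tthreshold e) (tlval u Nil)))
    (tmem (tstart e u) (tok e))) (ttl e).
Definition ttransducer (e i u : tree) : tree :=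
  Cons (tindex (tnodes e) (tstart e u))
    (tmap (fun s =>
      Cons (tmap (fun p => tif (lk (tctrl e i) p) (lk (tchoice e s) p) Nil) (tiota (tctrl e i)))
        (tmap (fun b => Cons b (tindex (tnodes e) (tstep e s (tchoice e s) b))) (tletters e)))
      (tnodes e)).
Definition tanswer (e : tree) : tree :=
  tif (tcandidates e)
    (tmap (fun i => ttransducer e i (thd (tcandidates e))) (tagents e)) Nil.

Lemma pt_tlval u i : ptime u -> ptime i -> ptime (fun z => tlval (u z) (i z)).
Proof. by move=> *; rewrite /tlval; pt. Qed.
Ltac pt_named ::= first [simple apply pt_tacc | simple apply pt_tcell | simple apply pt_ttargets
  | simple apply pt_tlval | pt_input].
Lemma pt_tmove e u b : ptime e -> ptime u -> ptime b -> ptime (fun z => tmove (e z) (u z) (b z)).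
Proof. by move=> *; rewrite /tmove /tmove1; pt. Qed.
Lemma pt_tsim e i a b : ptime e -> ptime i -> ptime a -> ptime b ->
  ptime (fun z => tsim (e z) (i z) (a z) (b z)).
Proof. by move=> *; rewrite /tsim; pt. Qed.
Lemma pt_tbad e i u : ptime e -> ptime i -> ptime u -> ptime (fun z => tbad (e z) (i z) (u z)).
Proof. by move=> *; rewrite /tbad; pt. Qed.
Lemma pt_thit e u j : ptime e -> ptime u -> ptime j -> ptime (fun z => thit (e z) (u z) (j z)).
Proof. by move=> *; rewrite /thit; pt. Qed.
Lemma pt_tnodes e : ptime e -> ptime (fun z => tnodes (e z)).
Proof. by move=> *; rewrite /tnodes; pt. Qed.
Ltac pt_arena := first [simple apply pt_tmove | simple apply pt_tsim | simple apply pt_tbad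
  | simple apply pt_thit | simple apply pt_tnodes | simple apply pt_tacc | simple apply pt_tcell
  | simple apply pt_ttargets | simple apply pt_tlval | pt_input].
Ltac pt_named ::= pt_arena.
Lemma pt_tmode e m a b : ptime e -> ptime m -> ptime a -> ptime b ->
  ptime (fun z => tmode (e z) (m z) (a z) (b z)).
Proof. by move=> *; rewrite /tmode /tculprit; pt. Qed.
Ltac pt_named ::= first [simple apply pt_tmode | pt_arena].
Lemma pt_tstep e s a b : ptime e -> ptime s -> ptime a -> ptime b ->
  ptime (fun z => tstep (e z) (s z) (a z) (b z)).
Proof. by move=> *; rewrite /tstep; pt. Qed.
Lemma pt_tallowed e s a : ptime e -> ptime s -> ptime a ->
  ptime (fun z => tallowed (e z) (s z) (a z)).
Proof. by move=> *; rewrite /tallowed; pt. Qed.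
Ltac pt_named ::= first [simple apply pt_tmode | simple apply pt_tstep | simple apply pt_tallowed
  | pt_arena].
Lemma pt_tchoices e x s : ptime e -> ptime x -> ptime s ->
  ptime (fun z => tchoices (e z) (x z) (s z)).
Proof. by move=> *; rewrite /tchoices /tgood; pt. Qed.
Lemma pt_tok e : ptime e -> ptime (fun z => tok (e z)).
Proof.
move=> he; apply: (pt_comp (f := tok)) he.
by apply: (@pt_gfp (fun x s e => tchoices e x s)); [apply: pt_tchoices; pt | pt].
Qed.
Ltac pt_named ::= first [simple apply pt_tstep | simple apply pt_tok | simple apply pt_tchoices
  | pt_arena].
Lemma pt_tchoice e s : ptime e -> ptime s -> ptime (fun z => tchoice (e z) (s z)).
Proof. by move=> *; rewrite /tchoice; pt. Qed.
Lemma pt_tcandidates e : ptime e -> ptime (fun z => tcandidates (e z)).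
Proof. by move=> *; rewrite /tcandidates /tinitial /tstart; pt. Qed.
Ltac pt_named ::= first [simple apply pt_tstep | simple apply pt_tchoice
  | simple apply pt_tcandidates | pt_arena].
Lemma pt_tanswer : ptime tanswer.
Proof. by rewrite /tanswer /ttransducer /tstart; pt. Qed.

(** * Correctness of the algorithm *)

Lemma enc_seqE T (f : T -> tree) s : enc_seq f s = tre (map f s).
Proof. by elim: s => //= a s ->. Qed.

Lemma lst_seq T (f : T -> tree) s : lst (enc_seq f s) = map f s.
Proof. by rewrite enc_seqE treK. Qed.

Lemma lst_fun (T : finType) (f : T -> tree) : lst (enc_fun f) = map f (enum T).
Proof. exact: lst_seq. Qed.

Lemma size_lst_nat n : size (lst (enc_nat n)) = n.
Proof. by rewrite lst_nat size_nseq. Qed.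

Lemma lk_nat s n : lk (tre s) (enc_nat n) = nth Nil s n.
Proof. by rewrite /lk treK size_lst_nat. Qed.

Lemma lk_fun (T : finType) (f : T -> tree) x : lk (enc_fun f) (enc_elt x) = f x.
Proof.
rewrite /enc_fun enc_seqE lk_nat (nth_map x) ?nth_enum_rank //.
by rewrite -cardE ltn_ord.
Qed.

Lemma map_enum_rank (T : finType) : [seq val (enum_rank x) | x <- enum T] = iota 0 #|T|.
Proof.
apply: (@eq_from_nth _ 0); first by rewrite size_map size_iota cardE.
move=> i; rewrite size_map => iT; have iT' : i < #|T| by rewrite cardE.
rewrite nth_iota // add0n; have x0 := enum_val (Ordinal iT').
rewrite (nth_map x0) //; have := enum_val_nth x0 (Ordinal iT') => /= <-.
by rewrite enum_valK.
Qed.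

Lemma enum_nonempty (T : finType) : enum T = [::] -> T -> False.
Proof. by move=> e x; have := mem_enum T x; rewrite e. Qed.

Lemma tiota_fun (T : finType) (f : T -> tree) : tiota (enc_fun f) = enc_fun (@enc_elt T).
Proof.
rewrite /tiota lst_fun size_map -cardE -map_enum_rank -map_comp /enc_fun.
by rewrite enc_seqE.
Qed.

Lemma tiota_seq T (f : T -> tree) s : tiota (tre (map f s)) = tre (map enc_nat (iota 0 (size s))).
Proof. by rewrite /tiota treK size_map. Qed.

Lemma tmap_seq T (f : T -> tree) g s : tmap g (tre (map f s)) = tre (map (g \o f) s).
Proof. by rewrite /tmap treK map_comp. Qed.

Lemma tmap_fun (T : finType) (f : T -> tree) g : tmap g (enc_fun f) = enc_fun (g \o f).
Proof. by rewrite /enc_fun !enc_seqE tmap_seq. Qed.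

Lemma tflat_seq T U (g : T -> tree) (f : T -> seq U) (h : U -> tree) s :
  (forall x, g x = tre (map h (f x))) ->
  tflat (tre (map g s)) = tre (map h (flatten (map f s))).
Proof.
move=> gE; rewrite /tflat treK -map_comp map_flatten -map_comp.
by congr (tre (flatten _)); apply: eq_map => x /=; rewrite gE treK.
Qed.

Lemma tunary_seq T (f : T -> tree) s : tunary (tre (map f s)) = enc_nat (size s).
Proof. by rewrite /tunary tmap_seq; elim: s => //= a s ->. Qed.

Lemma tb_bool b : tb (enc_bool b) = b. Proof. by case: b. Qed.

Lemma tb_nat n : tb (enc_nat n) = (0 < n). Proof. by case: n. Qed.

Lemma ttl_nat n : ttl (enc_nat n) = enc_nat n.-1. Proof. by case: n. Qed.

Lemma tifE b x y : tif b x y = if tb b then x else y. Proof. by case: b. Qed.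

Lemma enc_bool_inj : injective enc_bool.
Proof. by case=> [] []. Qed.

Lemma enc_nat_inj : injective enc_nat.
Proof. by move=> m n e; rewrite -(size_lst_nat m) e size_lst_nat. Qed.

Lemma enc_elt_inj (T : finType) : injective (@enc_elt T).
Proof. by move=> x y /enc_nat_inj/val_inj/enum_rank_inj. Qed.

Lemma enc_fun_inj (T : finType) (f g : T -> tree) : enc_fun f = enc_fun g -> f =1 g.
Proof. by move=> e x; rewrite -[LHS]lk_fun e lk_fun. Qed.

Lemma enc_set_inj (T : finType) : injective (@enc_set T).
Proof.
by move=> A B /enc_fun_inj e; apply/setP => x; have := congr1 tb (e x); rewrite !tb_bool.
Qed.

Lemma enc_ord n (i : 'I_n) : enc_elt i = enc_nat i.
Proof. by rewrite /enc_elt enum_rank_ord. Qed.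

Lemma tall_fun (T : finType) (f : T -> tree) p :
  tb (tall p (enc_fun f)) = [forall x, tb (p (f x))].
Proof.
rewrite tb_all lst_fun all_map; apply/allP/forallP => h x; last by move=> _; apply: h.
by apply: h; rewrite mem_enum.
Qed.

Lemma tfilter_fun (T : finType) (f : T -> tree) p :
  tfilter p (enc_fun f) = tre [seq f x | x <- enum T & tb (p (f x))].
Proof. by rewrite /tfilter lst_fun filter_map. Qed.

Lemma head_filter_iota (T : eqType) (x0 x : T) s : x \in s ->
  head 0 [seq k <- iota 0 (size s) | nth x0 s k == x] = index x s.
Proof.
elim: s => //= y s IH; rewrite inE eq_sym; case: eqP => //= _ xs.
rewrite -[1]/(1 + 0) iotaDl filter_map -IH //=.
have : has (fun k => nth x0 s k == x) (iota 0 (size s)).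
  by apply/hasP; exists (index x s); rewrite ?nth_index // mem_iota index_mem.
by rewrite has_filter; case: filter.
Qed.

Lemma tindexE (T : eqType) (f : T -> tree) s x : injective f -> x \in s ->
  tindex (tre (map f s)) (f x) = enc_nat (index x s).
Proof.
move=> f_inj xs; rewrite /tindex tiota_seq /tfilter treK filter_map -(head_filter_iota x xs).
rewrite (@eq_in_filter _ _ (fun k => nth x s k == x)) => [|k]; first by case: filter.
by rewrite mem_iota /= => ks; rewrite lk_nat tb_eq (nth_map x) // (inj_eq f_inj).
Qed.

Section Refinement.
Import Order.TTheory.
Variables (I : problem) (Us : seq (vertex I)).
Hypothesis UsP : forall u, u \in Us.
Notation agent := 'I_(nagents I).+1.
Notation letter := (letter I).
Implicit Types (i : agent) (a b : letter) (u : vertex I) (x y : lat I).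

Definition lenc i (s : local i) : tree :=
  Cons (enc_elt (laut s)) (Cons (enc_elt (lmeet s)) (enc_elt (lval s))).
Definition venc u : tree := enc_fun (fun i => lenc (u i)).
Definition nenc (s : node I) : tree :=
  Cons (enc_elt (nmode s)) (Cons (venc (nvert s)) (Cons (enc_nat (ntgt s)) (enc_nat (ncnt s)))).
Let K := size Us.
Let e := Cons (enc_problem I) (tre (map venc Us)).

Lemma venc_inj : injective venc.
Proof.
move=> u v /enc_fun_inj h; apply/ffunP => i; have := h i; rewrite /lenc /laut /lmeet /lval.
by case: (u i) (v i) => [q [x y]] [q' [x' y']] /= [/enc_elt_inj-> /enc_elt_inj-> /enc_elt_inj->].
Qed.

Lemma nenc_inj : injective nenc.
Proof.
move=> [m [u [j k]]] [m' [u' [j' k']]] [].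
rewrite /nmode /nvert /ntgt /ncnt /=.
by move=> /enc_elt_inj-> /venc_inj-> /enc_nat_inj-> /enc_nat_inj->.
Qed.

Lemma tleqE x y : tleq e (enc_elt x) (enc_elt y) = enc_bool (x <= y)%O.
Proof. by rewrite /tleq /= !lk_fun. Qed.
Lemma tmeetE x y : tmeet e (enc_elt x) (enc_elt y) = enc_elt (x `&` y)%O.
Proof. by rewrite /tmeet /= !lk_fun. Qed.
Lemma tthresholdE : tthreshold e = enc_elt (threshold I). Proof. by []. Qed.
Lemma tautomataE : tautomata e = enc_fun (fun i => Cons (enc_set (ctrl i)) (enc_ldbw (objective i))).
Proof. by []. Qed.
Lemma tagentsE : tagents e = enc_fun (@enc_elt agent).
Proof. by rewrite /tagents tautomataE tiota_fun. Qed.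
Lemma tvaluesE : tvalues e = enc_fun (@enc_elt (lat I)).
Proof. by rewrite /tvalues tiota_fun. Qed.
Lemma tctrlE i : tctrl e (enc_elt i) = enc_set (ctrl i).
Proof. by rewrite /tctrl tautomataE lk_fun. Qed.
Lemma tinitE i : tinit e (enc_elt i) = enc_elt (init (objective i)).
Proof. by rewrite /tinit tautomataE lk_fun. Qed.
Lemma trowE i (q : state (objective i)) : trow e (enc_elt i) (enc_elt q) =
  Cons (enc_elt (acc q)) (enc_fun (fun a => Cons (enc_set a)
              (Cons (enc_elt (next q a)) (enc_elt (weight q a))))).
Proof. by rewrite /trow tautomataE !lk_fun. Qed.
Lemma taccE i (q : state (objective i)) : tacc e (enc_elt i) (enc_elt q) = enc_elt (acc q).
Proof. by rewrite /tacc trowE. Qed.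
Lemma tcellE i (q : state (objective i)) a : tcell e (enc_elt i) (enc_elt q) (enc_set a) =
  Cons (enc_elt (next q a)) (enc_elt (weight q a)).
Proof.
rewrite /tcell trowE /= tfilter_fun.
have -> : [seq x <- enum letter | tb (teq (enc_set x) (enc_set a))] = [:: a].
  rewrite (eq_filter (a2 := pred1 a)) => [|x]; last by rewrite tb_eq (inj_eq (@enc_set_inj _)).
  by rewrite filter_pred1_uniq ?enum_uniq ?mem_enum.
by [].
Qed.
Lemma tlettersE : tletters e = enc_fun (@enc_set (vars I)).
Proof.
rewrite /tletters tautomataE {1}/enc_fun [enum 'I_(nagents I).+1]enum_ordSl /=.
rewrite {1}/enc_fun; case E: (enum (state (objective ord0))) => [|q s] /=.
  by case: (enum_nonempty E (init (objective ord0))).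
exact: tmap_fun.
Qed.
Lemma ttargetsE : ttargets e = tre [seq Cons (enc_elt t.1) (enc_elt t.2) | t <- targets I].
Proof.
rewrite /ttargets tagentsE tvaluesE tmap_fun /tflat lst_fun; congr tre.
rewrite /targets map_allpairs -map_comp; congr flatten; apply: eq_map => i /=.
by rewrite tmap_fun lst_fun.
Qed.

Lemma lk_venc u i : lk (venc u) (enc_elt i) = lenc (u i).
Proof. exact: lk_fun. Qed.
Lemma tlvalE u i : tlval (venc u) (enc_elt i) = enc_elt (lval (u i)).
Proof. by rewrite /tlval lk_venc. Qed.

Lemma tmoveE u b : tmove e (venc u) (enc_set b) = venc (move u b).
Proof.
rewrite /tmove tagentsE tmap_fun [RHS]/venc; congr enc_fun; apply/funext => i /=.
by rewrite lk_venc /tmove1 /= tcellE /= tmeetE ffunE.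
Qed.

Lemma tb_agent i : tb (enc_elt i) = (i != ord0).
Proof. by rewrite enc_ord tb_nat lt0n. Qed.

Lemma tsimE i a b : tb (tsim e (enc_elt i) (enc_set a) (enc_set b)) = sim i a b.
Proof.
rewrite /tsim tctrlE tiota_fun tall_fun; apply: eq_forallb => p.
rewrite tb_or tb_and tb_agent !lk_fun tb_bool tb_eq; congr orb.
by rewrite (inj_eq enc_bool_inj).
Qed.

Lemma tculpritE a b : tculprit e (enc_set a) (enc_set b) = enc_elt (culprit a b).
Proof.
rewrite /tculprit tagentsE tfilter_fun.
rewrite (eq_filter (a2 := fun i => sim i a b)) => [|i]; last by rewrite tsimE.
rewrite /culprit; case: (filter _ _) => //=.
by rewrite enc_ord.
Qed.

Lemma tbadE i u : tb (tbad e (enc_elt i) (venc u)) = bad i u.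
Proof. by rewrite /tbad lk_venc /= taccE tmeetE tlvalE tleqE tb_not tb_bool. Qed.

(** Past the end of the list the two lookups have different defaults. This is why the later
    correspondences assume [wf]. *)
Lemma thitE u j : j < size (targets I) -> tb (thit e (venc u) (enc_nat j)) = hit u j.
Proof.
move=> jJ; rewrite /thit ttargetsE lk_nat (nth_map (ord0, \top%O)) //=.
by rewrite lk_venc /= taccE tlvalE !tleqE tb_or tb_not !tb_bool.
Qed.

Lemma tmodeE m a b : tmode e (enc_elt m) (enc_set a) (enc_set b) = enc_elt (mode_after m a b).
Proof. by rewrite /tmode /mode_after tifE tb_agent tculpritE; case: eqP. Qed.

Lemma tKE : tunary (ttl e) = enc_nat K.
Proof. exact: tunary_seq. Qed.

Lemma tstepE s a b : wf K s -> tstep e (nenc s) (enc_set a) (enc_set b) = nenc (step K s a b).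
Proof.
case: s => [m [u [j k]]] /andP[jJ kK]; rewrite /tstep /= tmodeE tmoveE tKE.
rewrite !tifE !tb_agent tbadE thitE // tb_nat /nenc /step /=; congr (Cons _ (Cons _ _)).
rewrite ttargetsE tunary_seq !ttl_nat.
case: eqP => _ /=; last by case: eqP => _ //=; case: (bad _ _).
by case: (hit u j) => //=; case: j jJ kK.
Qed.

Lemma tallowedE s a : wf K s -> tb (tallowed e (nenc s) (enc_set a)) = allowed s a.
Proof.
case: s => [m [u [j k]]] /andP[jJ kK]; rewrite /tallowed /= tifE tb_agent /allowed /=.
case: eqP => _ /=; last by rewrite tb_or tb_not tbadE tb_nat implybE.
rewrite tb_and tb_or thitE // tb_nat tagentsE tall_fun; congr andb; apply: eq_forallb => i.
by rewrite lk_venc /= tcellE /= tlvalE tleqE tb_bool.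
Qed.

Definition nodes : seq (node I) :=
  flatten [seq flatten [seq flatten [seq [seq (m, (u, (j, k))) | k <- iota 0 K.+1]
    | j <- iota 0 (size (targets I))] | u <- Us] | m <- enum 'I_(nagents I).+1].

Lemma mem_nodes s : s \in nodes = wf K s.
Proof.
case: s => [m [u [j k]]]; apply/flatten_mapP/andP => [[m' _ /flatten_mapP[u' _]]|[jJ kK]].
  move=> /flatten_mapP[j' + /mapP[k' + [_ _ -> ->]]]; rewrite !mem_iota.
  by rewrite /ntgt /ncnt.
exists m; first by rewrite mem_enum.
apply/flatten_mapP; exists u => //; apply/flatten_mapP; exists j; first by rewrite mem_iota.
by apply/mapP; exists k; rewrite ?mem_iota.
Qed.

Lemma tnodesE : tnodes e =
  tre (map nenc nodes).
Proof.
have kE : tiota (Cons Nil (ttl e)) = tre (map enc_nat (iota 0 K.+1)).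
  by rewrite /tiota /= treK size_map.
rewrite /tnodes /nodes kE tagentsE /enc_fun enc_seqE !tmap_seq; move: (iota 0 K.+1) => ks.
apply: tflat_seq => m /=; rewrite tmap_seq; apply: tflat_seq => u /=.
rewrite ttargetsE tiota_seq tmap_seq; apply: tflat_seq => j /=.
by rewrite tmap_seq -map_comp.
Qed.

Lemma wf_step s a b : wf K s -> wf K (step K s a b).
Proof.
case: s => [m [u [j k]]] /andP[]; rewrite /wf /step /ntgt /ncnt /= => jJ kK.
do ![case: ifP => _ //=]; rewrite ?jJ ?leqnn //=; first by case: (j) jJ => /=; lia.
all: exact: leq_trans (leq_pred _) kK.
Qed.

Lemma tgoodE X s a : wf K s -> tb (tgood e X (nenc s) (enc_set a)) =
  allowed s a && [forall b, legal s a b ==> (nenc (step K s a b) \in lst X)].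
Proof.
move=> ws; rewrite tb_and tallowedE // tlettersE tall_fun; congr andb.
apply: eq_forallb => b; rewrite tb_or tb_not tb_mem tstepE // implybE.
by case: s {ws} => [m v]; rewrite /= tmodeE tsimE.
Qed.

Lemma tchoicesE X s : wf K s -> tchoices e X (nenc s) =
  tre [seq enc_set a | a <- enum letter &
    allowed s a && [forall b, legal s a b ==> (nenc (step K s a b) \in lst X)]].
Proof.
move=> ws; rewrite /tchoices tlettersE tfilter_fun; congr (tre (map _ _)).
by apply: eq_filter => a; rewrite tgoodE.
Qed.

Lemma tb_choices X s : wf K s -> reflect
  (exists2 a, allowed s a & forall b, legal s a b -> nenc (step K s a b) \in lst X)
  (tb (tchoices e X (nenc s))).
Proof.
move=> ws; rewrite tchoicesE // tb_tre -size_eq0 size_map size_eq0 -has_filter.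
apply: (iffP hasP) => [[a _ /andP[aa /forallP h]]|[a aa h]].
  by exists a => // b; apply/implyP.
by exists a; rewrite ?mem_enum // aa; apply/forallP => b; apply/implyP/h.
Qed.

Lemma tchoices_mono X Y s : {subset lst X <= lst Y} ->
  tb (tchoices e X s) -> tb (tchoices e Y s).
Proof.
move=> XY; rewrite !tb_filter; apply: sub_has => a; rewrite !tb_and => /andP[-> /=].
rewrite !tb_all; apply: sub_all => b; rewrite !tb_or !tb_mem => /orP[->//|/XY->].
by rewrite orbT.
Qed.

Lemma mem_tnodes s : (nenc s \in lst (tnodes e)) = wf K s.
Proof. by rewrite tnodesE treK mem_map ?mem_nodes //; apply: nenc_inj. Qed.

(** Two greatest fixpoints of one operator: the computed list is an invariant for [ok], and the
    classically filtered list of [ok] nodes is a post-fixpoint for [gfp_coind]. *)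
Lemma tokP s : reflect (ok K s) (nenc s \in lst (tok e)).
Proof.
apply: (iffP idP) => [h|oks].
  exists (fun t => nenc t \in lst (tok e)) => // t /(gfp_unfold (@tchoices_mono)).
  rewrite mem_tnodes => -[wt /(tb_choices _ wt)[a aa ha]]; split=> //; by exists a.
pose X := tre [seq nenc t | t <- nodes & `[< ok K t >]].
have inX t : ok K t -> nenc t \in lst X.
  move=> okt; rewrite treK; apply: map_f; rewrite mem_filter mem_nodes.
  by rewrite (ok_unfold okt).1 andbT; apply/asboolP.
apply: (gfp_coind (@tchoices_mono) (X := X)) (inX _ oks) => a; rewrite treK.
move=> /mapP[t]; rewrite mem_filter => /andP[/asboolP/ok_unfold[wt [b bb hb]] _] ->.
rewrite mem_tnodes wt; split=> //; apply/(tb_choices _ wt); exists b => // c /hb.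
exact: inX.
Qed.

Definition good s a : bool :=
  allowed s a && [forall b, legal s a b ==> (nenc (step K s a b) \in lst (tok e))].
Definition choice_of s : letter := head set0 (filter (good s) (enum letter) ++ enum letter).

Lemma choice_ofP s : ok K s -> allowed s (choice_of s) /\
  forall b, legal s (choice_of s) b -> ok K (step K s (choice_of s) b).
Proof.
move=> /ok_unfold[_ [a aa ha]].
have : a \in filter (good s) (enum letter).
  rewrite mem_filter mem_enum /good aa /= andbT; apply/forallP => b.
  by apply/implyP => /ha/tokP.
rewrite /choice_of; case E: (filter _ _) => [//|c r] _ /=.
have : c \in filter (good s) (enum letter) by rewrite E mem_head.
rewrite mem_filter => /andP[/andP[ac /forallP hc] _]; split=> // b /(implyP (hc b)).
exact: tokP.
Qed.

Lemma tchoiceE s : wf K s -> tchoice e (nenc s) = enc_set (choice_of s).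
Proof.
move=> ws; rewrite /tchoice tchoicesE // tlettersE /tcat treK lst_fun -map_cat /choice_of.
rewrite -/(good s); have : filter (good s) (enum letter) ++ enum letter <> [::].
  case: (filter _ _) => //=; exact: (fun E => enum_nonempty E set0).
by case: (_ ++ _).
Qed.

(** * The solved game as a family of transducers *)

Section Transducers.
Variable u0 : vertex I.
Let s0 : node I := (ord0, (u0, (0, K))).
Let N := (size nodes).-1.
Let nd (q : 'I_N.+1) := nth s0 nodes q.
Let code (s : node I) : 'I_N.+1 := inord (index s nodes).

(** States are positions in [nodes], so that the order in which the encoding enumerates them is that
    of the computed node list. *)
Definition choice_transducer i : transducer I :=
  @Transducer I 'I_N.+1 (code s0) (fun q b => code (step K (nd q) (choice_of (nd q)) b))
    (fun q => choice_of (nd q) :&: ctrl i).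

Lemma wf_start : wf K s0.
Proof.
rewrite /wf /ntgt /ncnt /= leqnn andbT size_allpairs -!cardE card_ord muln_gt0 /=.
by apply/card_gt0P; exists \top%O.
Qed.

Lemma size_nodes : N.+1 = size nodes.
Proof. by apply: prednK; case: nodes (mem_nodes s0) => //; rewrite wf_start. Qed.

Lemma val_code s : wf K s -> val (code s) = index s nodes.
Proof. by move=> ws; apply: inordK; rewrite size_nodes index_mem mem_nodes. Qed.

Lemma codeK s : wf K s -> nd (code s) = s.
Proof. by move=> ws; rewrite /nd [X in nth _ _ X]val_code // nth_index // mem_nodes. Qed.

Lemma wf_nd q : wf K (nd q).
Proof. by rewrite -mem_nodes mem_nth // -size_nodes. Qed.

Lemma choice_transducerE i :
  strategy_of_transducer (choice_transducer i) = choice_profile K choice_of u0 i.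
Proof.
have run_nd q h : nd (foldl (@tnext _ (choice_transducer i)) q h) =
    foldl (fun s b => step K s (choice_of s) b) (nd q) h.
  by elim: h q => //= b h IH q; rewrite IH codeK // wf_step // wf_nd.
by apply/funext => h; rewrite /strategy_of_transducer /= run_nd codeK // wf_start.
Qed.

Lemma enc_code s : wf K s -> enc_elt (code s) = tindex (tnodes e) (nenc s).
Proof.
by move=> ws; rewrite enc_ord tnodesE tindexE ?mem_nodes // ?[nat_of_ord _]val_code //; apply: nenc_inj.
Qed.

Lemma enc_fun_nd (f : node I -> tree) : enc_fun (fun q => f (nd q)) = tre (map f nodes).
Proof.
rewrite /enc_fun enc_seqE; congr tre.
have -> : [seq f (nd q) | q <- enum 'I_N.+1] =
    [seq f s | s <- [seq nth s0 nodes k | k <- [seq val q | q <- enum 'I_N.+1]]].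
  by rewrite -!map_comp.
by rewrite val_enum_ord size_nodes -/(mkseq _ _) mkseq_nth.
Qed.

Lemma ttransducerE i : ttransducer e (enc_elt i) (venc u0) = enc_transducer (choice_transducer i).
Proof.
rewrite /ttransducer /enc_transducer /= (enc_code wf_start); congr Cons.
  by rewrite /tstart tKE /s0 /nenc /nmode enc_ord.
apply: etrans (esym (enc_fun_nd (fun s => Cons (enc_set (choice_of s :&: ctrl i))
  (enc_fun (fun b => Cons (enc_set b) (enc_elt (code (step K s (choice_of s) b)))))))).
rewrite [X in tmap _ X]tnodesE tmap_seq; congr tre; apply/eq_in_map => s; rewrite mem_nodes => ws /=.
rewrite tchoiceE // tctrlE tiota_fun tmap_fun tlettersE tmap_fun; congr Cons.
  by congr enc_fun; apply/funext => p /=; rewrite !lk_fun tifE tb_bool inE andbC; case: (p \in ctrl i).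
congr enc_fun; apply/funext => b /=.
by rewrite tstepE // -enc_code // wf_step.
Qed.
End Transducers.

Lemma tcandidatesE : tcandidates e = tre [seq venc u | u <- Us &
  [&& [forall i, (laut (u i) == init (objective i)) && [forall y : lat I, (y <= lmeet (u i))%O]],
    (threshold I <= lval (u ord0))%O & nenc (ord0, (u, (0, K))) \in lst (tok e)]].
Proof.
rewrite /tcandidates /tfilter [ttl e]/= treK filter_map; congr (tre (map _ _)).
apply: eq_filter => u /=; rewrite !tb_and tb_mem -andbA; congr [&& _, _ & _].
- rewrite /tinitial tagentsE tall_fun; apply: eq_forallb => i.
  rewrite tb_and tb_eq lk_venc /= tinitE (inj_eq (@enc_elt_inj _)) tvaluesE tall_fun.
  by congr andb; apply: eq_forallb => y; rewrite tleqE tb_bool.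
- have -> : Nil = enc_elt (ord0 : agent) by rewrite enc_ord.
  by rewrite tlvalE tthresholdE tleqE tb_bool.
- by rewrite /tstart tKE /nenc /nmode enc_ord.
Qed.

Lemma tanswerP : answer I (tanswer e).
Proof.
have leK : #|vertex I| <= K.
  by rewrite cardE; apply: uniq_leq_size; [apply: enum_uniq | move=> u _; apply: UsP].
rewrite /tanswer tifE; have := tcandidatesE; case E: (filter _ _) => [|u r] -> /=.
  right; split=> // -[pi /(completeness leK)[u [ui ut uo]]].
  have : u \in [::]; last by [].
  rewrite -E mem_filter UsP andbT ut /=; apply/andP; split; last exact/tokP.
  apply/forallP => i; have [-> ->] := ui i; rewrite eqxx; apply/forallP => y; exact: lex1.
have : u \in u :: r by exact: mem_head.
rewrite -E mem_filter => /andP[/and3P[/forallP ui ut /tokP uo] _]; left.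
exists (choice_transducer u).
  have -> : (fun i => strategy_of_transducer (choice_transducer u i)) = choice_profile K choice_of u.
    by apply/funext => i; apply: choice_transducerE.
  apply: choice_profile_solution => // [|i]; first exact: choice_ofP.
  have /andP[/eqP-> /forallP h] := ui i; split=> //.
  by apply/le_anti; rewrite lex1 h.
rewrite tagentsE tmap_fun; congr enc_fun; apply/funext => i /=; exact: ttransducerE.
Qed.
End Refinement.

(** * The product of the local state spaces *)

Definition tlocals (e i : tree) : tree :=
  tflat (tmap (fun q => tflat (tmap (fun x => tmap (fun w => Cons q (Cons x w))
    (tvalues e)) (tvalues e))) (tiota (ttl (ttl (lk (tautomata e) i))))).
Definition textend (l acc : tree) : tree :=
  tflat (tmap (fun a => tmap (Cons a) acc) l).

Lemma pt_tlocals e : ptime e -> ptime (fun z => tmap (tlocals (e z)) (tagents (e z))).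
Proof.
by move=> he; apply: (@pt_map (fun i z => tlocals (e z) i)); rewrite /ptime2 /tlocals; pt.
Qed.

Lemma pt_textend : ptime3 (fun l acc _ => textend l acc).
Proof. by rewrite /ptime3 /textend; pt. Qed.

Lemma lst_textend l acc : lst (textend l acc) = [seq Cons a r | a <- lst l, r <- lst acc].
Proof. by rewrite !treK -map_comp; congr flatten; apply: eq_map => a /=; rewrite treK. Qed.

(** A tuple takes one item per list, so it is no larger than the lists together; the number of
    tuples is a product of lengths, each at most 2 to the size of its list. *)
Lemma product_size fs : let acc := foldr textend (Cons Nil Nil) fs in
  all (fun t => tsize t <= tsize (tre fs)) (lst acc) /\ size (lst acc) <= 2 ^ tsize (tre fs).
Proof.
elim: fs => [|l fs [IHa IHs]] //=; rewrite lst_textend; split.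
  apply/allP => _ /allpairsP[[a r] [al rl ->]] /=.
  by have := allP (lst_small l) a al; have := allP IHa r rl => /=; lia.
rewrite size_allpairs.
apply: leq_trans (leq_mul (leq_trans (size_lst l) (ltnW (ltn_expl _ (ltnSn 1)))) IHs) _.
by rewrite -expnD leq_exp2l.
Qed.

Lemma product_tsize fs :
  tsize (foldr textend (Cons Nil Nil) fs) <= 2 ^ (tsize (tre fs)).*2.+1.
Proof.
have [/tsize_tre_le le sz] := product_size fs; rewrite -[foldr _ _ _]lstK.
set D := tsize (tre fs) in le sz *; apply: leq_trans le _; rewrite expnS -addnn expnD.
have := leq_mul sz (ltn_expl D (ltnSn 1)).
by have : 0 < 2 ^ D * 2 ^ D; [rewrite muln_gt0 !expn_gt0 | lia].
Qed.

Section Vertices.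
Variable I : problem.
Let e := Cons (enc_problem I) Nil.

Lemma lst_tlocals i : exists s : seq (local i),
  lst (tlocals e (enc_elt i)) = map (@lenc I i) s /\ forall v, v \in s.
Proof.
have aE : tautomata e =
    enc_fun (fun i : 'I_(nagents I).+1 => Cons (enc_set (ctrl i)) (enc_ldbw (objective i))).
  exact: (@tautomataE I [::]).
have vE : tvalues e = enc_fun (@enc_elt (lat I)) by exact: (@tvaluesE I [::]).
pose s : seq (local i) := flatten [seq flatten [seq [seq (q, (x, w)) | w <- enum (lat I)]
   | x <- enum (lat I)] | q <- enum (state (objective i))].
exists s; split; last first.
  case=> q [x w]; apply/flatten_mapP; exists q; first by rewrite mem_enum.
  apply/flatten_mapP; exists x; first by rewrite mem_enum.
  by apply: map_f; rewrite mem_enum.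
have -> : tlocals e (enc_elt i) = tre (map (@lenc I i) s); last by rewrite treK.
rewrite /tlocals aE vE lk_fun /= tiota_fun tmap_fun /enc_fun !enc_seqE.
apply: tflat_seq => q /=; rewrite tmap_seq; apply: tflat_seq => x /=.
by rewrite tmap_seq -map_comp.
Qed.

Let U := foldr textend (Cons Nil Nil) (lst (tmap (tlocals e) (tagents e))).

Lemma lst_vertices : exists2 Us : seq (vertex I), U = tre (map (@venc I) Us) & forall u, u \in Us.
Proof.
have agE : tagents e = enc_fun (@enc_elt 'I_(nagents I).+1) by exact: (@tagentsE I [::]).
have extend l ls : foldr textend (Cons Nil Nil) (l :: ls) = textend l (foldr textend (Cons Nil Nil) ls) by [].
(* A vertex is assembled by overriding it at one agent after another; as [s] has no repetition, an
   override leaves the rest of the tuple intact. *)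
have Us_of s : uniq s -> forall t,
    t \in lst (foldr textend (Cons Nil Nil) [seq tlocals e (enc_elt i) | i <- s]) <->
    exists u : vertex I, t = tre [seq lenc (u i) | i <- s].
  elim: s => [_ t|i s IH].
    rewrite [lst _]/= inE; split=> [/eqP->|[u ->]]; last exact: eqxx.
    by exists [ffun i => (init (objective i), (\top%O, \top%O))].
  have [vs [vsE vsP]] := lst_tlocals i; rewrite cons_uniq => /andP[nis us] t.
  rewrite [map _ (i :: s)]map_cons extend lst_textend vsE; split=> [/allpairsP|[u ->]].
    move=> [[a r] [/mapP[v _ ->] /(IH us)[u ->] ->]].
    exists (finfun (dfwith u v) : vertex I); rewrite map_cons ffunE dfwith_in.
    congr (tre (_ :: _)); apply/eq_in_map => j js; rewrite ffunE dfwith_out //.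
    by apply: contraNneq nis => ->.
  apply/allpairsP; exists (lenc (u i), tre [seq lenc (u j) | j <- s]); split=> //.
    exact: map_f.
  by apply/(IH us); exists u.
have UE t : t \in lst U <-> exists u : vertex I, t = venc u.
  rewrite /U agE tmap_fun lst_fun Us_of ?enum_uniq //.
  by split=> -[u ->]; exists u; rewrite /venc /enc_fun enc_seqE.
have [Us UsE] : exists Us, lst U = map (@venc I) Us.
  have : forall t, t \in lst U -> exists u : vertex I, t = venc u by move=> t /UE.
  elim: (lst U) => [|t r IH] h; first by exists [::].
  have [u tu] := h t (mem_head _ _); have [|Us ->] := IH.
    by move=> t' t'r; apply: h; rewrite inE t'r orbT.
  by exists (u :: Us); rewrite tu.
exists Us => [|u]; first by rewrite -UsE lstK.
by rewrite -(mem_map (@venc_inj I)) -UsE; apply/UE; exists u.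
Qed.

End Vertices.

(** * Exponential bounds and the complete program *)

Definition expb (f : tree -> nat) : Prop := exists2 g, polyb g & forall x, f x <= 2 ^ g x.

Lemma expb_poly f : polyb f -> expb f.
Proof. by exists f => // x; apply/ltnW/ltn_expl. Qed.

Lemma expbD f g : expb f -> expb g -> expb (fun x => f x + g x).
Proof.
move=> [f' pf hf] [g' pg hg]; exists (fun x => (f' x + g' x).+1).
  exact: polybS (polybD pf pg).
move=> x; rewrite expnS expnD; have := hf x; have := hg x.
have := expn_gt0 2 (f' x); have := expn_gt0 2 (g' x) => /=.
move: (2 ^ f' x) (2 ^ g' x) => p q; nia.
Qed.

Lemma expbX f c : expb f -> expb (fun x => f x ^ c).
Proof.
move=> [f' pf hf]; exists (fun x => f' x * c); first exact: polybM pf (polyb_cst c).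
by move=> x; rewrite expnM leq_expl.
Qed.

(** For positive [n], [(n + 1) ^ c] is at most [2 ^ c * n ^ c], and [c] is at most [2 ^ c]; so
    [2 ^ c] can be both factor and exponent. *)
Lemma expb_normal f : expb f -> exists c, forall x, f x <= 2 ^ (c * tsize x ^ c + c).
Proof.
move=> [g [c hg] hf]; exists (2 ^ c) => x; apply: leq_trans (hf x) _; rewrite leq_exp2l //.
apply: leq_trans (hg x) _; apply: leq_trans (leq_addr _ _).
have le : (tsize x).+1 <= 2 * tsize x by have := tsize_gt0 x; lia.
apply: leq_trans (leq_expl c le) _; rewrite expnMn leq_mul2l; apply/orP; right.
by apply: leq_pexp2l (tsize_gt0 x) (ltnW (ltn_expl _ _)).
Qed.

Theorem theorem4 : solvable_in_exptime enc_problem answer.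
Proof.
(* The initial loop state for [fold_time]: the local state spaces, reversed because the product is a
   right fold, the list with only the empty tuple, and the problem. *)
pose f1 x := Cons (trev (tmap (tlocals (Cons x Nil)) (tagents (Cons x Nil)))) (Cons (Cons Nil Nil) x).
have pf1 : ptime f1.
  apply: pt_cons; last by pt.
  by apply: pt_rev; apply: (@pt_tlocals (fun x => Cons x Nil)); pt.
(* Rearranges the final loop state into the environment of the algorithm. *)
pose f3 y := tanswer (Cons (ttl (ttl y)) (thd (ttl y))).
have pf3 : ptime f3 by apply: (pt_comp pt_tanswer); pt.
pose U x := foldr textend (Cons Nil Nil) (lst (tmap (tlocals (Cons x Nil)) (tagents (Cons x Nil)))).
pose B x := 2 ^ (tsize (f1 x)).*2.+1.
have [p1 [c1 h1]] := pf1; have [p2 [c2 h2]] := fold_time pt_textend; have [p3 [c3 h3]] := pf3.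
have expB : expb B.
  exists (fun x => (tsize (f1 x)).*2.+1) => //; have h := ptime_size pf1.
  by apply: polybS; apply: polyb_le (polybD h h) _ => x; rewrite addnn.
(* One summand per phase, and 2 for the sequencing. The third is polynomial in the size of the
   vertex list and covers the size of the answer too. *)
pose T x := (tsize x).+1 ^ c1 + (B x + 1) ^ c2 + (B x + (tsize x + 4)) ^ c3 + 2.
have expT : expb T.
  have cst k : expb (fun=> k) by apply/expb_poly/polyb_cst.
  apply: expbD (cst _); apply: expbD; first apply: expbD.
  - by apply/expb_poly/polybX/polybS/polyb_size.
  - by apply/expbX/expbD.
  - by apply/expbX/expbD => //; apply/expb_poly/polybD; [exact: polyb_size | exact: polyb_cst].
have [c hc] := expb_normal expT; exists (PSeq (PSeq p1 p2) p3), c => I.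
set x := enc_problem I; have [Us UE UsP] := lst_vertices I.
have foldU k : foldl (fun acc a => textend a acc) (Cons Nil Nil) (take k (lst (thd (f1 x)))) =
    foldr textend (Cons Nil Nil) (rev (take k (lst (thd (f1 x))))).
  by rewrite -foldl_rev revK.
have B1 : tsize (f1 x) <= B x.
  by apply: leq_trans (ltnW (ltn_expl _ (ltnSn 1))) _; rewrite leq_exp2l //; lia.
have [t1 e1 le1] := h1 x.
have [|||t2 e2 le2] := h2 (thd (f1 x)) (Cons Nil Nil) x (B x).
- move=> k; rewrite foldU; apply: leq_trans (product_tsize _) _; rewrite leq_exp2l //.
  by rewrite ltnS leq_double; apply: leq_trans (tsize_rev_take _ _) _; rewrite /=; lia.
- by apply: leq_trans B1; rewrite /=; lia.
- by apply: leq_trans B1; rewrite /=; lia.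
have UEx : foldl (fun acc a => textend a acc) (Cons Nil Nil) (lst (thd (f1 x))) = U x.
  by rewrite -[lst _]take_size foldU take_size /f1 /= trevE treK revK.
rewrite UEx in e2; have [t3 e3 le3] := h3 (Cons Nil (Cons (U x) x)).
have Ule : tsize (U x) <= B x.
  rewrite -UEx -[lst _]take_size foldU; apply: leq_trans (product_tsize _) _.
  rewrite leq_exp2l // ltnS leq_double; apply: leq_trans (tsize_rev_take _ _) _.
  by rewrite /=; lia.
exists (f3 (Cons Nil (Cons (U x) x))), ((t1 + t2).+1 + t3).+1; split.
- exact: EvSeq (EvSeq e1 e2) e3.
- apply: leq_trans (hc x); rewrite /T.
  have le4 : (tsize (Cons Nil (Cons (U x) x))).+1 ^ c3 <= (B x + (tsize x + 4)) ^ c3.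
    by apply: leq_expl; rewrite /=; lia.
  by move: le1 le2 le3 le4; rewrite addn1 => ????; lia.
- by rewrite /f3 /= [U x]UE; apply: tanswerP.
Qed.
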